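(* Consider the finite-sum problem $\min_{\omega\in\mathbb{R}^d}F(\omega)$ and the SODDA algorithm described in the context. Suppose: (2) $F$ is strongly convex with parameter $\xi>0$; (3) there is $L\ge 1$ such that $\|\nabla f_i(x_i\omega)-\nabla f_i(x_i\hat\omega)\|\le L\|\omega-\hat\omega\|$ for all $\omega,\hat\omega\in\mathbb{R}^d$ and all $i$; (4) there is a constant $G$ such that $\frac{1}{N-1}\sum_{j=1}^N\left(\|\nabla f_j(x_j\omega^t)\|^2-\|\nabla F(\omega^t)\|^2\right)\le G^2$ for all iterates $\omega^t$; (5) there is a constant $M_2$ such that $\|\omega^t\|\le\frac{M_2}{2}$ for all $t$, and also $\|\omega^*\|\le\frac{M_2}2$. Suppose $b_t=d$ and $s_t=N$ for all $t$, with arbitrary positive integers $c_t\le d$, and that the learning rate is constant, $\gamma_t=\gamma$, with $$\gamma\in\left(0,\min\left\{1,\frac1{BLQP},\gamma_1,\gamma_2\right\}\right),$$ where $\gamma_1,\gamma_2$ are the positive constants given for $r=1,2$ by $$\gamma_r=-2\sqrt{\frac{\bar B_r}{3\bar C_r}}\,\sinh\left(\frac13\operatorname{arcsinh}\left(-\frac{3\bar A_r}{2\bar B_r}\sqrt{\frac{3\bar C_r}{\bar B_r}}\right)\right),$$ $\bar A_1=\frac{\min_t c_t}{Ld}$, $\bar B_1=B+\frac{(B-1)BLQP}{\xi}$, $\bar C_1=B^4(1+B^3L^2QP)L^2QP$, $\bar A_2=\frac{\min_t c_t}{d}$, $\bar B_2=(B-1)BLQP+LB$, $\bar C_2=B^4(1+B^3L^2QP)L^3QP$.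 Then the sequence of parameters $\omega^t$ generated by SODDA converges to $\omega^*$, that is $$\lim_{t\to\infty}\|\omega^t-\omega^*\|=0.$$
   Context: Problem. $N,d,P,Q$ are positive integers with $P\mid N$ and $QP\mid d$; put $n=N/P$, $\tilde m=d/(QP)$. Data: row vectors $x_i$ with $x_i^T\in\mathbb{R}^d$, and differentiable functions $f_i:\mathbb{R}\to\mathbb{R}$ ($f_i=\bar f(\cdot,y_i)$ for a loss $\bar f$ and label $y_i$), $i=1,\dots,N$. $F(\omega)=\frac1N\sum_{i=1}^N f_i(x_i\omega)$. $\nabla f_i(x_i\omega)\in\mathbb{R}^d$ denotes the gradient with respect to $\omega$ of $\omega\mapsto f_i(x_i\omega)$. Norms are Euclidean. It is assumed throughout that $F$ has a unique minimizer $\omega^*$. Partitioning. The $N$ observations are split into $P$ partitions of $n$ observations each; the $d$ features are split into $Q$ blocks, each further split into $P$ sub-blocks of size $\tilde m$. Accordingly $\omega=(\omega_{1,1},\dots,\omega_{1,P},\omega_{2,1},\dots,\omega_{Q,P})$ with $\omega_{q,k}\in\mathbb{R}^{\tilde m}$. For $p,k\in\{1,\dots,P\}$, $q\in\{1,\dots,Q\}$, $j\in\{1,\dots,n\}$, $x_j^{p,q,k}$ is the restriction of the $j$-th observation of observation partition $p$ to feature sub-block $(q,k)$, and $f_j^p$ is the function $f_i$ of that observation. $\nabla_{\omega_{q,k}}f_j^p(x_j^{p,q,k}\omega_{q,k})\in\mathbb{R}^{\tilde m}$ is the gradient of $\omega_{q,k}\mapsto f_j^p(x_j^{p,q,k}\omega_{q,k})$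 (only the local sub-block enters the inner product). SODDA. Inputs: integer $B\ge1$ (batch size), positive learning rates $(\gamma_t)_{t\ge1}$, integers $1\le c_t\le b_t\le d$, $1\le s_t\le N$ for $t\ge0$. Start with $\omega^0=0$. For $t=0,1,2,\dots$: - sample $\mathcal B_t\subseteq\{1,\dots,d\}$ of size $b_t$ uniformly without replacement; sample $\mathcal C_t\subseteq\mathcal B_t$ of size $c_t$ uniformly without replacement; sample $\mathcal D_t\subseteq\{1,\dots,N\}$ of size $s_t$ uniformly without replacement; - let $\mu^t=\frac1{s_t}\sum_{j\in\mathcal D_t}g_j$, where $g_j\in\mathbb{R}^d$ has $k$-th coordinate $f_j'\big(\sum_{l\in\mathcal B_t}(x_j)_l\,\omega^t_l\big)(x_j)_k$ if $k\in\mathcal C_t$ and $0$ otherwise; - for each $q$, select a (random) bijection $\pi_q$ of $\{1,\dots,P\}$; - for all $p,q$ in parallel, with $k=\pi_q(p)$: set $\bar\omega^{(0)}_{q,k}=\omega^t_{q,k}$, and for $i=0,\dots,B-1$ pick $j\in\{1,\dots,n\}$ uniformly at random (freshly for each $p,q,i$) and set $$\bar\omega^{(i+1)}_{q,k}=\bar\omega^{(i)}_{q,k}-\gamma_{t+1}\Big[\nabla_{\omega_{q,k}}f_j^p(x_j^{p,q,k}\bar\omega^{(i)}_{q,k})-\nabla_{\omega_{q,k}}f_j^p(x_j^{p,q,k}\omega^t_{q,k})+\mu^t_{q,k}\Big],$$ where $\mu^t_{q,k}$ is the $(q,k)$ sub-block of $\mu^t$; - $\omega^{t+1}$ is the concatenation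 of all $\bar\omega^{(B)}_{q,k}$. All random choices are made independently of the past and of each other, except that $\mathcal C_t$ is drawn from $\mathcal B_t$. *)

(* Defs.v *)
From HB Require Import structures.
From mathcomp Require Import all_boot all_order all_algebra all_fingroup.
From mathcomp Require Import finmap.
From mathcomp Require Import all_classical all_reals all_analysis.
Set Implicit Arguments.
Unset Strict Implicit.
Unset Printing Implicit Defensive.
Import Order.TTheory GRing.Theory Num.Theory.
Import numFieldNormedType.Exports.
Local Open Scope classical_set_scope.
Local Open Scope ring_scope.

(* The norm that the library puts on matrices is the sup norm. *)
Definition enorm (R : realType) (m : nat) (u : 'cV[R]_m) : R :=
  Num.sqrt (\sum_(i < m) u i 0 ^+ 2).

Definition inner (R : realType) (m : nat) (a : 'rV[R]_m) (u : 'cV[R]_m) : R :=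
  (a *m u) 0 0.

Definition grad (R : realType) (m : nat) (g : 'cV[R]_m -> R) (u : 'cV[R]_m) :
    'cV[R]_m :=
  \col_k 'D_(delta_mx k 0 : 'cV[R]_m) g u.

Definition strongly_convex (R : realType) (m : nat) (xi : R)
    (g : 'cV[R]_m -> R) : Prop :=
  forall (u v : 'cV[R]_m) (a : R), 0 <= a <= 1 ->
    g (a *: u + (1 - a) *: v) <=
      a * g u + (1 - a) * g v
      - xi / 2%:R * a * (1 - a) * enorm (u - v) ^+ 2.

Definition unique_minimizer (R : realType) (m : nat) (g : 'cV[R]_m -> R)
    (u : 'cV[R]_m) : Prop :=
  (forall v, g u <= g v) /\
  (forall v, (forall v', g v <= g v') -> v = u).

Definition sinh (R : realType) (z : R) : R := (expR z - expR (- z)) / 2%:R.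

Definition arcsinh (R : realType) (z : R) : R :=
  ln (z + Num.sqrt (z ^+ 2 + 1)).

Lemma seq_value_ex (c : nat -> nat) : exists m, `[< exists t, c t = m >].
Proof. by exists (c 0%N); apply/asboolP; exists 0%N. Qed.

Definition min_seq (c : nat -> nat) : nat := ex_minn (seq_value_ex c).

Definition loss_at (R : realType) (N d : nat) (x : 'I_N -> 'rV[R]_d)
    (f : 'I_N -> R -> R) (i : 'I_N) (w : 'cV[R]_d) : R :=
  f i (inner (x i) w).

Definition objective (R : realType) (N d : nat) (x : 'I_N -> 'rV[R]_d)
    (f : 'I_N -> R -> R) (w : 'cV[R]_d) : R :=
  N%:R^-1 * \sum_(i < N) loss_at x f i w.

Lemma feat_subproof (d P Q : nat) (hQPd : (Q * P %| d)%N)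
    (q : 'I_Q) (k : 'I_P) (l : 'I_(d %/ (Q * P))) :
  ((q * P + k) * (d %/ (Q * P)) + l < d)%N.
Proof.
set m := (d %/ _)%N in l *.
have hd : d = (Q * P * m)%N by rewrite mulnC divnK.
have hqk : (q * P + k < Q * P)%N.
  apply: (@leq_trans (q.+1 * P)%N); first by rewrite mulSn addnC ltn_add2r.
  by rewrite leq_mul2r ltn_ord orbT.
rewrite hd; apply: (@leq_trans ((q * P + k).+1 * m)%N).
  by rewrite mulSn addnC ltn_add2r.
by rewrite leq_mul2r hqk orbT.
Qed.

(* Coordinates of R^d are ordered as (w_{1,1}, ..., w_{1,P}, w_{2,1}, ...,
   w_{Q,P}); all indices start at 0. *)
Definition feat (d P Q : nat) (hQPd : (Q * P %| d)%N)
    (q : 'I_Q) (k : 'I_P) (l : 'I_(d %/ (Q * P))) : 'I_d :=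
  Ordinal (feat_subproof hQPd q k l).

Definition subblock (R : realType) (d P Q : nat) (hQPd : (Q * P %| d)%N)
    (w : 'cV[R]_d) (q : 'I_Q) (k : 'I_P) : 'cV[R]_(d %/ (Q * P)) :=
  \col_l w (feat hQPd q k l) 0.

Definition row_subblock (R : realType) (d P Q : nat) (hQPd : (Q * P %| d)%N)
    (a : 'rV[R]_d) (q : 'I_Q) (k : 'I_P) : 'rV[R]_(d %/ (Q * P)) :=
  \row_l a 0 (feat hQPd q k l).

(* Every coordinate lies in exactly one sub-block, so this is the vector whose
   (q, k) sub-block is v q k. *)
Definition concat_blocks (R : realType) (d P Q : nat) (hQPd : (Q * P %| d)%N)
    (v : 'I_Q -> 'I_P -> 'cV[R]_(d %/ (Q * P))) : 'cV[R]_d :=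
  \sum_(q < Q) \sum_(k < P) \sum_(l < d %/ (Q * P))
    v q k l 0 *: delta_mx (feat hQPd q k l) 0.

Definition grad_estimate (R : realType) (N d : nat) (x : 'I_N -> 'rV[R]_d)
    (f : 'I_N -> R -> R) (s : nat) (Bs Cs : {set 'I_d}) (Ds : {set 'I_N})
    (w : 'cV[R]_d) : 'cV[R]_d :=
  s%:R^-1 *: \sum_(j in Ds) \col_k
    (if k \in Cs
     then derive1 (f j) (\sum_(l in Bs) x j 0 l * w l 0) * x j 0 k
     else 0).

Definition local_grad (R : realType) (N d P Q : nat) (hQPd : (Q * P %| d)%N)
    (x : 'I_N -> 'rV[R]_d) (f : 'I_N -> R -> R)
    (i : 'I_N) (q : 'I_Q) (k : 'I_P) :
    'cV[R]_(d %/ (Q * P)) -> 'cV[R]_(d %/ (Q * P)) :=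
  grad (fun u => f i (inner (row_subblock hQPd (x i) q k) u)).

(* The B inner steps carried out on sub-block (q, k) by observation partition
   p, where obs (p, j) is the j-th observation of partition p and js lists the
   successively picked observations. *)
Definition inner_loop (R : realType) (N d P Q B : nat)
    (hQPd : (Q * P %| d)%N) (obs : 'I_P * 'I_(N %/ P) -> 'I_N)
    (x : 'I_N -> 'rV[R]_d) (f : 'I_N -> R -> R) (gam : R) (w mu : 'cV[R]_d)
    (q : 'I_Q) (p k : 'I_P) (js : 'I_B -> 'I_(N %/ P)) :
    'cV[R]_(d %/ (Q * P)) :=
  foldl (fun u (i : 'I_B) =>
      let g := local_grad hQPd x f (obs (p, js i)) q k in
      u - gam *: (g u - g (subblock hQPd w q k) + subblock hQPd mu q k))
    (subblock hQPd w q k) (enum 'I_B).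

(* Sub-block (q, k) is processed by the partition p such that k = sg q p. *)
Definition sodda_step (R : realType) (N d P Q B : nat)
    (hQPd : (Q * P %| d)%N) (obs : 'I_P * 'I_(N %/ P) -> 'I_N)
    (x : 'I_N -> 'rV[R]_d) (f : 'I_N -> R -> R) (gam : R) (s : nat)
    (Bs Cs : {set 'I_d}) (Ds : {set 'I_N}) (sg : 'I_Q -> {perm 'I_P})
    (js : 'I_P -> 'I_Q -> 'I_B -> 'I_(N %/ P)) (w : 'cV[R]_d) : 'cV[R]_d :=
  let mu := grad_estimate x f s Bs Cs Ds w in
  concat_blocks hQPd (fun q k =>
    let p := ((sg q)^-1)%g k in
    inner_loop hQPd obs x f gam w mu q p k (js p q)).

(* Labels of the random choices: coordinate sets (B_t, C_t), observation set
   D_t, bijection pi_q, and i-th pick of partition p for feature block q. *)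
Inductive draw (P Q B : nat) : Type :=
| CoordDraw of nat
| ObsDraw of nat
| PermDraw of nat & 'I_Q
| PickDraw of nat & 'I_P & 'I_Q & 'I_B.
Arguments CoordDraw {P Q B}.
Arguments ObsDraw {P Q B}.
Arguments PermDraw {P Q B}.
Arguments PickDraw {P Q B}.

HB.instance Definition _ (P Q B : nat) := gen_eqMixin (draw P Q B).
HB.instance Definition _ (P Q B : nat) := gen_choiceMixin (draw P Q B).

Definition draw_val (N d P Q B : nat) (i : draw P Q B) : finType :=
  match i with
  | CoordDraw _ => ({set 'I_d} * {set 'I_d})%type
  | ObsDraw _ => {set 'I_N}
  | PermDraw _ _ => {perm 'I_P}
  | PickDraw _ _ _ _ => 'I_(N %/ P)
  end.

Fixpoint sodda (R : realType) (N d P Q B : nat) (T : Type)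
    (hQPd : (Q * P %| d)%N) (obs : 'I_P * 'I_(N %/ P) -> 'I_N)
    (x : 'I_N -> 'rV[R]_d) (f : 'I_N -> R -> R) (gam : nat -> R)
    (s : nat -> nat) (X : forall i : draw P Q B, T -> draw_val N d i)
    (t : nat) (o : T) : 'cV[R]_d :=
  match t with
  | 0 => 0
  | t'.+1 =>
    sodda_step hQPd obs x f (gam t'.+1) (s t')
      (X (CoordDraw t') o).1 (X (CoordDraw t') o).2 (X (ObsDraw t') o)
      (fun q => X (PermDraw t' q) o) (fun p q i => X (PickDraw t' p q i) o)
      (sodda hQPd obs x f gam s X t' o)
  end.

Definition mutually_independent (R : realType) (disp : measure_display)
    (T : measurableType disp) (Pr : probability T R)
    (I : choiceType) (V : I -> finType) (X : forall i, T -> V i) : Prop :=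
  forall (J : {fset I}) (A : forall i, {set V i}),
    fine (Pr (\bigcap_(i in [set` J]) [set o | X i o \in A i])) =
    \prod_(i <- J) fine (Pr [set o | X i o \in A i]).

(* No law is imposed on the bijections pi_q. *)
Definition sodda_sampling (R : realType) (disp : measure_display)
    (T : measurableType disp) (Pr : probability T R)
    (N d P Q B : nat) (b c s : nat -> nat)
    (X : forall i : draw P Q B, T -> draw_val N d i) : Prop :=
  [/\ forall i (A : {set draw_val N d i}), measurable [set o | X i o \in A],
      mutually_independent Pr X,
      (forall t (S : {set 'I_d}), #|S| = b t ->
         Pr [set o | (X (CoordDraw t) o).1 = S] = ('C(d, b t)%:R^-1)%:E)
      /\ (forall t (S S' : {set 'I_d}), #|S| = b t -> S' \subset S ->
         #|S'| = c t ->
         Pr [set o | X (CoordDraw t) o = (S, S')] =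
           (Pr [set o | (X (CoordDraw t) o).1 = S] *
            ('C(b t, c t)%:R^-1)%:E)%E),
      forall t (S : {set 'I_N}), #|S| = s t ->
         Pr [set o | X (ObsDraw t) o = S] = ('C(N, s t)%:R^-1)%:E &
      forall t p q i (j : 'I_(N %/ P)),
         Pr [set o | X (PickDraw t p q i) o = j] = ((N %/ P)%:R^-1)%:E].

Definition rate_bound (R : realType) (A B C : R) : R :=
  - 2%:R * Num.sqrt (B / (3%:R * C)) *
    sinh (3%:R^-1 *
      arcsinh (- (3%:R * A / (2%:R * B)) * Num.sqrt (3%:R * C / B))).

Definition gamma1 (R : realType) (B Q P d cmin : nat) (L xi : R) : R :=
  rate_bound
    (cmin%:R / (L * d%:R))
    (B%:R + (B%:R - 1) * B%:R * L * Q%:R * P%:R / xi)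
    (B%:R ^+ 4 * (1 + B%:R ^+ 3 * L ^+ 2 * Q%:R * P%:R) * L ^+ 2 * Q%:R * P%:R).

Definition gamma2 (R : realType) (B Q P d cmin : nat) (L : R) : R :=
  rate_bound
    (cmin%:R / d%:R)
    ((B%:R - 1) * B%:R * L * Q%:R * P%:R + L * B%:R)
    (B%:R ^+ 4 * (1 + B%:R ^+ 3 * L ^+ 2 * Q%:R * P%:R) * L ^+ 3 * Q%:R * P%:R).

(* Main.v *)
(* With b_t = d and s_t = N the vector mu^t is almost surely the full gradient
   g = grad F(w^t) masked by C_t. Put a = gamma L. A Gronwall estimate on each
   sub-block gives |w^{t+1} - w^t + gamma B mu^t| <= gamma B a (B - 1) |mu^t|
   for every outcome of the picks and of the bijections, so the descent lemma
   yields F(w^{t+1}) + gamma B sum_{k in C_t} g_k^2 <=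
   F(w^t) + gamma B (a B^2) |g|^2.
   Since C_t is independent of w^t, the expectation of sum_{k in C_t} g_k^2 is
   (c_t / d) E|g|^2, and gamma < gamma_2 gives a B^2 < min_t c_t / d. By the
   Polyak-Lojasiewicz inequality 2 xi (F - F_min) <= |g|^2, the expected gaps
   E(F(w^t) - F_min) telescope to a finite sum, so F(w^t) - F_min -> 0 almost surely
   and strong convexity gives w^t -> w*. *)

Require Import Defs.
From HB Require Import structures.
From mathcomp Require Import all_boot all_order all_algebra all_fingroup.
From mathcomp Require Import finmap.
From mathcomp Require Import all_classical all_reals all_analysis.
From mathcomp Require Import measurable_realfun ring lra.
Set Implicit Arguments.
Unset Strict Implicit.
Unset Printing Implicit Defensive.
Import Order.TTheory GRing.Theory Num.Theory.
Import numFieldNormedType.Exports.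
Local Open Scope classical_set_scope.
Local Open Scope ring_scope.

(** * Euclidean geometry of column vectors *)

Section Euclidean.
Variables (R : realType) (m : nat).
Implicit Types (a : 'rV[R]_m) (u v : 'cV[R]_m).

Lemma innerE a u : inner a u = \sum_j a 0 j * u j 0.
Proof. by rewrite /inner mxE. Qed.

Lemma innerDr a u v : inner a (u + v) = inner a u + inner a v.
Proof. by rewrite /inner mulmxDr mxE. Qed.

Lemma innerZr a (k : R) u : inner a (k *: u) = k * inner a u.
Proof. by rewrite /inner -scalemxAr mxE. Qed.

Lemma innerBr a u v : inner a (u - v) = inner a u - inner a v.
Proof. by rewrite innerDr -scaleN1r innerZr mulN1r. Qed.

Lemma enorm_ge0 u : 0 <= enorm u.
Proof. exact: sqrtr_ge0. Qed.

Lemma sqr_enorm u : enorm u ^+ 2 = \sum_i u i 0 ^+ 2.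
Proof. by rewrite sqr_sqrtr // sumr_ge0 // => i _; rewrite sqr_ge0. Qed.

Lemma enorm_eq0 u : enorm u = 0 -> u = 0.
Proof.
move=> /(congr1 (fun z => z ^+ 2)); rewrite sqr_enorm expr0n/= => /eqP.
rewrite psumr_eq0 => [/allP h|i _]; last exact: sqr_ge0.
apply/matrixP => i j; rewrite ord1 mxE; apply/eqP; rewrite -sqrf_eq0.
by apply: (implyP (h i _)); rewrite ?mem_index_enum.
Qed.

Lemma enormZ (k : R) u : enorm (k *: u) = `|k| * enorm u.
Proof.
rewrite /enorm -sqrtr_sqr -sqrtrM ?sqr_ge0// mulr_sumr.
by congr Num.sqrt; apply: eq_bigr => i _; rewrite mxE exprMn.
Qed.

Lemma enorm0 : enorm (0 : 'cV[R]_m) = 0.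
Proof. by rewrite -(scale0r (0 : 'cV[R]_m)) enormZ normr0 mul0r. Qed.

Lemma enormN u : enorm (- u) = enorm u.
Proof. by rewrite -scaleN1r enormZ normrN1 mul1r. Qed.

Lemma sqr_enormD u v :
  enorm (u + v) ^+ 2 = enorm u ^+ 2 + inner u^T v *+ 2 + enorm v ^+ 2.
Proof.
rewrite !sqr_enorm innerE -sumrMnl -!big_split/=.
by apply: eq_bigr => i _; rewrite !mxE sqrrD.
Qed.

(** Cauchy-Schwarz: expanding the squared norm of |v| u - |u| v yields 0 <= |u| |v| (|u| |v| - <u,
    v>), and the positive factor cancels. Vectors of norm zero are treated first. *)
Lemma inner_le_enorm u v : inner u^T v <= enorm u * enorm v.
Proof.
have [/enorm_eq0 ->|u0] := eqVneq (enorm u) 0.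
  by rewrite innerE big1 ?mulr_ge0 ?enorm_ge0// => i _; rewrite !mxE mul0r.
have [/enorm_eq0 ->|v0] := eqVneq (enorm v) 0.
  by rewrite innerE big1 ?mulr_ge0 ?enorm_ge0// => i _; rewrite !mxE mulr0.
have up : 0 < enorm u by rewrite lt_def u0 enorm_ge0.
have vp : 0 < enorm v by rewrite lt_def v0 enorm_ge0.
have := sqr_ge0 (enorm (enorm v *: u + (- enorm u) *: v)).
rewrite sqr_enormD !enormZ innerZr normrN !ger0_norm ?enorm_ge0//.
have -> : inner (enorm v *: u)^T v = enorm v * inner u^T v.
  by rewrite !innerE mulr_sumr; apply: eq_bigr => i _; rewrite !mxE mulrA.
set s := inner _ _ => h.
have {}h : 0 <= (enorm u * enorm v) * (enorm u * enorm v - s) by nra.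
by rewrite -subr_ge0 -(pmulr_rge0 _ (mulr_gt0 up vp)).
Qed.

Lemma norm_inner_le_enorm u v : `|inner u^T v| <= enorm u * enorm v.
Proof.
rewrite ler_norml inner_le_enorm andbT lerNl -mulN1r -innerZr scaleN1r.
by rewrite (le_trans (inner_le_enorm _ _))// enormN.
Qed.

Lemma ler_enormD u v : enorm (u + v) <= enorm u + enorm v.
Proof.
rewrite -(ler_pXn2r (n := 2))// ?nnegrE ?addr_ge0 ?enorm_ge0//.
by rewrite sqr_enormD sqrrD lerD2r lerD2l lerMn2r/= inner_le_enorm.
Qed.

End Euclidean.

(** * Decomposition of coordinates into sub-blocks *)

Section BlockCoordinates.
Variables (R : realType) (d P Q : nat) (hQPd : (Q * P %| d)%N).
Local Notation blk := (d %/ (Q * P))%N.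

(** The coordinate number is a mixed-radix expansion with digits [q], [k], [l], which quotients and
    remainders by the block size and by [P] recover. *)
Lemma feat_inj :
  injective (fun i : 'I_Q * 'I_P * 'I_blk => feat hQPd i.1.1 i.1.2 i.2).
Proof.
move=> [[q k] l] [[q' k'] l'] /= [] h.
have blk0 : (0 < blk)%N by apply: leq_ltn_trans (ltn_ord l).
have P0 : (0 < P)%N by apply: leq_ltn_trans (ltn_ord k).
have hl : l = l' :> nat.
  by move/(congr1 (modn^~ blk)): h; rewrite !modnMDl !modn_small.
have hqk : (q * P + k = q' * P + k')%N.
  by move/(congr1 (divn^~ blk)): h; rewrite !divnMDl// !divn_small// !addn0.
have hk : k = k' :> nat.
  by move/(congr1 (modn^~ P)): hqk; rewrite !modnMDl !modn_small.
have hq : q = q' :> nat.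
  by move/(congr1 (divn^~ P)): hqk; rewrite !divnMDl// !divn_small// !addn0.
by congr (_, _, _); apply: val_inj.
Qed.

Lemma feat_bij :
  bijective (fun i : 'I_Q * 'I_P * 'I_blk => feat hQPd i.1.1 i.1.2 i.2).
Proof.
apply: inj_card_bij feat_inj _.
by rewrite !card_prod !card_ord mulnC divnK.
Qed.

Lemma sum_feat (V : nmodType) (E : 'I_d -> V) :
  \sum_i E i = \sum_q \sum_k \sum_l E (feat hQPd q k l).
Proof.
rewrite (reindex _ (onW_bij _ feat_bij)) /=.
by rewrite pair_big/= pair_big/=; apply: eq_bigr => -[[]].
Qed.

Lemma concat_blocksE (v : 'I_Q -> 'I_P -> 'cV[R]_blk) q k l :
  concat_blocks hQPd v (feat hQPd q k l) 0 = v q k l 0.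
Proof.
rewrite /concat_blocks pair_big/= pair_big/= summxE.
rewrite (bigD1 (q, k, l))//= big1 => [|[[q' k'] l'] ne] /=.
  by rewrite !mxE !eqxx mulr1 addr0.
rewrite !mxE [_ == _]negbTE ?mulr0//.
by apply: contra_neq ne => h; apply/esym/feat_inj.
Qed.

Lemma sqr_enorm_blocks (w : 'cV[R]_d) :
  enorm w ^+ 2 = \sum_q \sum_k enorm (subblock hQPd w q k) ^+ 2.
Proof.
rewrite sqr_enorm sum_feat; apply: eq_bigr => q _; apply: eq_bigr => k _.
by rewrite sqr_enorm; apply: eq_bigr => l _; rewrite mxE.
Qed.

End BlockCoordinates.

(** * Derivatives along lines and first-order Taylor bounds *)

Section Derivatives.
Variable R : realType.

Lemma derive_dir (f : R -> R) (z v : R) :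
  derivable f z 1 -> 'D_v f z = derive1 f z * v.
Proof.
move=> /derivable1_diffP df; rewrite derive1E !deriveE//.
by rewrite -{1}[v]mulr1 -[v * 1]/(v *: (1 : R)) linearZ/= mulrC.
Qed.

(** The difference quotient along the [i]-th basis vector is literally that of [f] at [inner a u] in
    direction [a 0 i], so a one-variable derivative suffices. *)
Lemma grad_inner m (f : R -> R) (a : 'rV[R]_m) (u : 'cV[R]_m) :
  derivable f (inner a u) 1 ->
  grad (fun w => f (inner a w)) u = derive1 f (inner a u) *: a^T.
Proof.
move=> df; apply/matrixP => i j; rewrite ord1 !mxE -derive_dir// /derive.
rewrite (_ : (fun h : R => _) = fun h : R =>
  h^-1 *: ((f \o shift (inner a u)) (h *: a 0 i) - f (inner a u)))//.
apply: funext => h /=; congr (_ *: (f _ - _)).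
rewrite innerDr innerZr; congr (_ * _ + _).
rewrite innerE (bigD1 i)//= big1 ?addr0 => [|k ki]; rewrite !mxE.
  by rewrite !eqxx mulr1.
by rewrite (negbTE ki) mulr0.
Qed.

(** The mean value theorem is applied on [0, 1] to [g], the Taylor remainder along the segment minus
    K t^2 / 2. The hypothesis makes its derivative nonpositive there, so [f] is not recovered by
    integrating its derivative. *)
Lemma taylor1_le (f : R -> R) (y h K : R) :
  (forall z, derivable f z 1) ->
  (forall t, 0 <= t <= 1 -> (derive1 f (y + t * h) - derive1 f y) * h <= K * t) ->
  f (y + h) - f y - derive1 f y * h <= K / 2.
Proof.
move=> df hK.
pose g t := f (y + t * h) - t * (derive1 f y * h) - K / 2 * t ^+ 2.
pose dg t := derive1 f (y + t * h) * h - derive1 f y * h - K * t.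
have hg (t : R) : is_derive t 1 g (dg t).
  have h1 : is_derive t 1 (cst y + h \*: (id : R -> R)) h.
    have := is_deriveD (is_derive_cst y t (1 : R))
      (is_deriveZ h (is_derive_id t (1 : R))).
    by rewrite add0r -[h *: _]/(h * _) mulr1.
  have h2 : is_derive ((cst y + h \*: (id : R -> R)) t) 1 f
      (derive1 f (y + t * h)).
    by rewrite [t * h]mulrC; split; [exact: df|rewrite derive1E].
  have h3 := is_derive1_comp h2 h1.
  have h4 := is_deriveB (is_deriveB h3
    (is_deriveZ (derive1 f y * h) (is_derive_id t (1 : R))))
    (is_deriveZ (K / 2) (is_deriveX 2 (is_derive_id t (1 : R)))).
  rewrite (_ : g = f \o (cst y + h \*: (id : R -> R)) -
      (derive1 f y * h) \*: (id : R -> R) - (K / 2) \*: ((id : R -> R) ^+ 2)).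
    apply: (is_derive_eq h4).
    by rewrite /dg /= -![_ *: _]/(_ * _) !mulr1; lra.
  apply: funext => s; rewrite /g !fctE /= -![_ *: _]/(_ * _).
  by rewrite [s * h]mulrC [s * (_ * _)]mulrC.
have cg : {within `[0, 1], continuous g}.
  apply: continuous_subspaceT => z.
  by apply: differentiable_continuous; apply/derivable1_diffP; case: (hg z).
have [c c01] := MVT ltr01 (fun z _ => hg z) cg.
rewrite subr0 mulr1 /g /dg => e.
move: c01; rewrite in_itv/= => /andP[/ltW c0 /ltW c1].
have := hK c; rewrite c0 c1 => /(_ isT) => hc.
have : f (y + 1 * h) - 1 * (derive1 f y * h) - K / 2 * 1 ^+ 2 -
   (f (y + 0 * h) - 0 * (derive1 f y * h) - K / 2 * 0 ^+ 2) <= 0 by rewrite e; lra.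
by rewrite mul1r mul0r addr0; lra.
Qed.

Lemma taylor1_norm_le (f : R -> R) (y h K : R) :
  (forall z, derivable f z 1) ->
  (forall t, 0 <= t <= 1 -> `|(derive1 f (y + t * h) - derive1 f y) * h| <= K * t) ->
  `|f (y + h) - f y - derive1 f y * h| <= K / 2.
Proof.
move=> df hK.
have h1 : f (y + h) - f y - derive1 f y * h <= K / 2.
  by apply: taylor1_le => // t t01; apply: le_trans (hK t t01); exact: ler_norm.
have dN z : derive1 (- f) z = - derive1 f z by rewrite !derive1E deriveN.
have h2 : (- f) (y + h) - (- f) y - derive1 (- f) y * h <= K / 2.
  apply: taylor1_le => [z|t t01]; first exact: derivableN.
  apply: le_trans (hK t t01); apply: le_trans (ler_norm _) _.
  by rewrite !dN -opprD mulNr normrN.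
rewrite ler_norml h1 andbT; move: h2; rewrite dN /= !fctE; lra.
Qed.

End Derivatives.

(** * The cubic root behind the learning-rate thresholds *)

Lemma min_seq_le c t : (min_seq c <= c t)%N.
Proof.
by rewrite /min_seq; case: ex_minnP => m _; apply; apply/asboolP; exists t.
Qed.

Section RateBound.
Variable R : realType.

Lemma arcsinhK (z : R) : sinh (arcsinh z) = z.
Proof.
rewrite /sinh /arcsinh; set s := Num.sqrt _.
have s2 : s ^+ 2 = z ^+ 2 + 1 by rewrite sqr_sqrtr// addr_ge0 ?sqr_ge0.
have s0 : 0 <= s by exact: sqrtr_ge0.
have zs : 0 < z + s.
  by have [z0|z0] := ltP 0 z; nra.
rewrite expRN lnK ?posrE//.
(* This is s^2 - z^2 = 1 in factored form. *)
have -> : (z + s)^-1 = s - z.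
  by apply: (mulfI (lt0r_neq0 zs)); rewrite mulfV ?lt0r_neq0//; nra.
by field.
Qed.

(** The triple-argument formula is what makes the hyperbolic solution of a depressed cubic work. *)
Lemma sinh_third (y : R) :
  sinh y = 4 * sinh (3^-1 * y) ^+ 3 + 3 * sinh (3^-1 * y).
Proof.
rewrite {1}(_ : y = 3 * (3^-1 * y)); last by field.
set u := 3^-1 * y; rewrite /sinh !expRN.
have -> : expR (3 * u) = expR u ^+ 3 by rewrite mulrC expRM_natr.
have := expR_gt0 u; move: (expR u) => e e0.
by field; lra.
Qed.

(* [rate_bound A B C] is the real root of [C g^3 + B g = A]. *)
Lemma rate_bound_le (A B C : R) :
  0 <= A -> 0 < B -> 0 < C -> B * rate_bound A B C <= A.
Proof.
move=> A0 B0 C0; rewrite /rate_bound.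
set r1 := Num.sqrt (B / _); set r2 := Num.sqrt (_ / B).
have r12 : r1 * r2 = 1.
  rewrite -sqrtrM ?divr_ge0 ?mulr_ge0 ?ltW//.
  by rewrite (_ : _ * _ = 1) ?sqrtr1//; field; lra.
have r10 : 0 <= r1 by exact: sqrtr_ge0.
have r20 : 0 <= r2 by exact: sqrtr_ge0.
set k := - _ * r2; have := sinh_third (arcsinh k); rewrite arcsinhK.
set S := sinh _ => hk.
have k0 : k <= 0.
  by rewrite /k mulNr oppr_le0 mulr_ge0// divr_ge0// mulr_ge0// ltW.
have S0 : S <= 0.
  rewrite leNgt; apply/negP => Sp.
  by have : 0 < S ^+ 3 := exprn_gt0 3 Sp; lra.
have S3 : S ^+ 3 <= 0.
  by rewrite exprS mulr_le0_ge0// sqr_ge0.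
(* In k = 4 S^3 + 3 S the cubic term is nonpositive and is dropped; this amounts to dropping C g^3
   from the cubic equation for the root. *)
have h : - (3 * S) <= - k by lra.
have : B * (2 * r1 / 3) * (- (3 * S)) <= B * (2 * r1 / 3) * (- k).
  by rewrite ler_wpM2l// mulr_ge0 ?(ltW B0)// divr_ge0// mulr_ge0.
rewrite (_ : _ * - k = A * (r1 * r2)); last by rewrite /k; field; lra.
by rewrite r12 mulr1; lra.
Qed.

End RateBound.

(** * Drift of the variance-reduced inner loop *)

Section InnerLoop.
Variables (R : realType) (m : nat) (S : Type) (g : S -> 'cV[R]_m -> 'cV[R]_m).
Variables (L gam : R) (u0 mu : 'cV[R]_m).
Hypotheses (gam0 : 0 <= gam) (L0 : 0 <= L).
Hypothesis g_lip : forall i u v, enorm (g i u - g i v) <= L * enorm (u - v).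

(** Both bounds are proved by one induction. The first one and the Lipschitz property bound the
    correction [g i u - g i u0] after n steps by 2 n gam L |mu|. Under the step-size condition this
    keeps each move below 2 gam |mu|, and summing 2 n over the steps produces the factor n (n - 1)
    of the second bound. *)
Lemma foldl_drift (s : seq S) :
  let n := (size s)%:R in
  let u := foldl (fun u i => u - gam *: (g i u - g i u0 + mu)) u0 s in
  2 * gam * L * (n - 1) <= 1 ->
  enorm (u - u0) <= 2 * n * gam * enorm mu /\
  enorm (u - u0 + (gam * n) *: mu) <= gam ^+ 2 * L * n * (n - 1) * enorm mu.
Proof.
elim/last_ind: s => [|s i IHs] /=.
  by rewrite mulr0n subrr !(mulr0, mul0r) scale0r addr0 enorm0.
rewrite size_rcons foldl_rcons; move: IHs => /=.
set n := (size s)%:R; set u := foldl _ _ _ => IHs.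
rewrite -[(size s).+1%:R]natr1 -/n addrK => hn.
have n0 : 0 <= n by rewrite ler0n.
have gL0 : 0 <= gam * L by rewrite mulr_ge0.
have [|hu hp] := IHs; first by nra.
have g0 : enorm (g i u - g i u0) <= L * (2 * n * gam * enorm mu).
  by rewrite (le_trans (g_lip _ _ _))// ler_wpM2l.
have mu0 := enorm_ge0 mu.
split.
  rewrite (_ : _ - u0 = (u - u0) + ((- gam) *: (g i u - g i u0) + (- gam) *: mu)).
    rewrite (le_trans (ler_enormD _ _))// (le_trans (lerD hu (ler_enormD _ _)))//.
    rewrite !enormZ normrN ger0_norm//.
    have : gam * enorm (g i u - g i u0) <= gam * (L * (2 * n * gam * enorm mu)).
      by rewrite ler_wpM2l.
    have : 2 * gam * L * n * (gam * enorm mu) <= 1 * (gam * enorm mu).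
      by rewrite ler_wpM2r// mulr_ge0.
    lra.
  by rewrite -scalerDr scaleNr addrAC.
rewrite (_ : _ + _ *: mu = (u - u0 + (gam * n) *: mu) + (- gam) *: (g i u - g i u0)).
  rewrite (le_trans (ler_enormD _ _))// (le_trans (lerD hp (lexx _)))//.
  rewrite !enormZ normrN ger0_norm//.
  have : gam * enorm (g i u - g i u0) <= gam * (L * (2 * n * gam * enorm mu)).
    by rewrite ler_wpM2l.
  lra.
by apply/matrixP => j l; rewrite !mxE; ring.
Qed.

End InnerLoop.

(** * Smoothness of the objective and descent in one outer step *)

Section Problem.
Variables (R : realType) (N d : nat) (x : 'I_N -> 'rV[R]_d) (f : 'I_N -> R -> R).
Variable L : R.
Hypothesis hf : forall i z, derivable (f i) z 1.
Hypothesis L0 : 0 <= L.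
Hypothesis hN : (0 < N)%N.
Hypothesis hLip : forall i (w w' : 'cV[R]_d),
  enorm (grad (loss_at x f i) w - grad (loss_at x f i) w') <= L * enorm (w - w').

(** The gradient in the closed form given by the chain rule. That it is the first-order term of the
    objective enters through [objective_taylor]. *)
Definition objective_grad (w : 'cV[R]_d) : 'cV[R]_d :=
  N%:R^-1 *: \sum_j derive1 (f j) (inner (x j) w) *: (x j)^T.
Local Notation dF := objective_grad.

Lemma norm_inner_le m (a : 'rV[R]_m) u : `|inner a u| <= enorm a^T * enorm u.
Proof. by rewrite -{1}[a]trmxK norm_inner_le_enorm. Qed.

Lemma derive1_inner_lip i w w' :
  `|derive1 (f i) (inner (x i) w) - derive1 (f i) (inner (x i) w')| *
    enorm (x i)^T <= L * enorm (w - w').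
Proof.
have := hLip i w w'; rewrite /loss_at !grad_inner//.
by rewrite -scalerBl enormZ.
Qed.

(** Any real y equals x_i w for w = (y / |x_i|^2) x_i^T, so the gradient hypothesis tested on the
    line spanned by x_i^T makes the scalar derivative Lipschitz with constant L / |x_i|^2.
    Multiplying by |x_i|^2 lets the statement cover x_i = 0. *)
Lemma derive1_lip i y y' :
  `|derive1 (f i) y - derive1 (f i) y'| * enorm (x i)^T ^+ 2 <= L * `|y - y'|.
Proof.
have [->|xi0] := eqVneq (enorm (x i)^T) 0.
  by rewrite expr0n/= mulr0 mulr_ge0.
have xp : 0 < enorm (x i)^T by rewrite lt_def xi0 enorm_ge0.
have ixx : inner (x i) (x i)^T = enorm (x i)^T ^+ 2.
  by rewrite sqr_enorm innerE; apply: eq_bigr => j _; rewrite mxE expr2.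
have hy z : inner (x i) ((z / enorm (x i)^T ^+ 2) *: (x i)^T) = z.
  by rewrite innerZr ixx divfK// expf_neq0.
have := derive1_inner_lip i ((y / enorm (x i)^T ^+ 2) *: (x i)^T)
  ((y' / enorm (x i)^T ^+ 2) *: (x i)^T).
rewrite !hy -scalerBl -mulrBl enormZ normrM normfV (ger0_norm (sqr_ge0 _))//.
move: (enorm _) xp {xi0 ixx hy} => e ep h.
rewrite expr2 mulrA -ler_pdivlMr//; apply: le_trans h _.
rewrite le_eqVlt; apply/orP; left; apply/eqP; field; lra.
Qed.

Lemma inner_objective_grad w v :
  inner (dF w)^T v =
  N%:R^-1 * \sum_j derive1 (f j) (inner (x j) w) * inner (x j) v.
Proof.
rewrite /dF innerE.
under eq_bigr => k _ do rewrite !mxE summxE -mulrA mulr_suml.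
rewrite -mulr_sumr exchange_big/=; congr (_ * _); apply: eq_bigr => j _.
rewrite [inner _ v]innerE mulr_sumr; apply: eq_bigr => k _.
by rewrite !mxE mulrA.
Qed.

(** Each summand is a one-variable Taylor bound with increment x_i v and K = L |v|^2. The upper side
    gives the descent estimate, the lower side the tangent inequality under strong convexity. *)
Lemma objective_taylor w v :
  `|objective x f (w + v) - objective x f w - inner (dF w)^T v| <=
  L / 2 * enorm v ^+ 2.
Proof.
rewrite inner_objective_grad /objective -!mulrBr normrM -!sumrB.
rewrite ger0_norm ?invr_ge0// ler_pdivrMl ?ltr0n//.
apply: le_trans (ler_norm_sum _ _ _) _.
rewrite mulr_natl -[X in _ *+ X]card_ord -sumr_const ler_sum// => i _.
rewrite /loss_at innerDr.
have -> : L / 2 * enorm v ^+ 2 = (L * enorm v ^+ 2) / 2 by lra.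
apply: taylor1_norm_le => // t /andP[t0 _].
rewrite normrM.
have := derive1_inner_lip i (w + t *: v) w.
rewrite addrAC subrr add0r enormZ innerDr innerZr (ger0_norm t0) => h.
apply: le_trans (ler_wpM2l (normr_ge0 _) (norm_inner_le _ _)) _.
rewrite mulrA expr2 mulrA [_ * enorm v * t]mulrAC ler_wpM2r ?enorm_ge0//.
by rewrite -mulrA [enorm v * t]mulrC.
Qed.

Section Blocks.
Variables (P Q : nat) (hQPd : (Q * P %| d)%N).

Lemma enorm_subblock_le (w : 'cV[R]_d) q k : enorm (subblock hQPd w q k) <= enorm w.
Proof.
rewrite -(ler_pXn2r (n := 2))// ?nnegrE ?enorm_ge0//.
rewrite [leRHS](sqr_enorm_blocks hQPd) (bigD1 q)//= (bigD1 k)//= -addrA.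
by rewrite lerDl addr_ge0// sumr_ge0// => *; rewrite ?sumr_ge0// => *;
  rewrite sqr_ge0.
Qed.

(** The local gradient evaluates the scalar derivative at a partial inner product, so it is not a
    block of the full gradient. The bound goes through [derive1_lip] instead: the restricted row [a]
    satisfies |a| <= |x_i|, and one factor |a| cancels. *)
Lemma local_grad_lip i q k u v :
  enorm (local_grad hQPd x f i q k u - local_grad hQPd x f i q k v) <=
  L * enorm (u - v).
Proof.
rewrite /local_grad !grad_inner// -scalerBl enormZ.
set a := row_subblock _ _ _ _.
have ha : enorm a^T <= enorm (x i)^T.
  rewrite (_ : a^T = subblock hQPd (x i)^T q k) ?enorm_subblock_le//.
  by apply/matrixP => j l; rewrite !mxE.
have [->|a0] := eqVneq (enorm a^T) 0; first by rewrite mulr0 mulr_ge0 ?enorm_ge0.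
have ap : 0 < enorm a^T by rewrite lt_def a0 enorm_ge0.
have h1 := derive1_lip i (inner a u) (inner a v).
have h2 := norm_inner_le a (u - v); rewrite innerBr in h2.
set D := `|_ - _| in h1 *.
have h3 : D * enorm a^T ^+ 2 <= D * enorm (x i)^T ^+ 2.
  by rewrite ler_wpM2l ?normr_ge0// ler_pXn2r// nnegrE enorm_ge0.
rewrite -(ler_pM2r ap) -mulrA -expr2 (le_trans h3)// (le_trans h1)//.
by rewrite -mulrA ler_wpM2l// mulrC.
Qed.

Lemma grad_estimate_full (Cs : {set 'I_d}) w k :
  grad_estimate x f N [set: 'I_d]%SET Cs [set: 'I_N]%SET w k 0 =
  if k \in Cs then dF w k 0 else 0.
Proof.
rewrite /grad_estimate /dF !mxE !summxE; case: ifP => kC.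
  congr (_ * _); rewrite big_mkcond/=; apply: eq_bigr => j _.
  rewrite inE !mxE kC innerE; congr (derive1 (f j) _ * _).
  by apply: eq_bigl => l; rewrite inE.
by rewrite big1 ?mulr0// => j _; rewrite mxE kC.
Qed.

Variables (B : nat) (obs : 'I_P * 'I_(N %/ P) -> 'I_N) (gam : R).
Hypotheses (hB : (0 < B)%N) (gam0 : 0 < gam) (hgam : gam * L * B%:R ^+ 2 <= 1).

(** One outer step is a masked gradient step of length gam B plus a drift error. The masked step
    contributes the sum over [Cs], because <dF, mu> = |mu|^2; drift and curvature together are
    absorbed by the last term on the right. *)
Lemma sodda_step_descent Cs sg (js : 'I_P -> 'I_Q -> 'I_B -> 'I_(N %/ P)) w :
  objective x f (sodda_step hQPd obs x f gam N [set: 'I_d]%SET Cs [set: 'I_N]%SET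
    sg js w) + gam * B%:R * \sum_(k in Cs) dF w k 0 ^+ 2 <=
  objective x f w + gam * B%:R * (gam * L * B%:R ^+ 2) * enorm (dF w) ^+ 2.
Proof.
set w' := sodda_step _ _ _ _ _ _ _ _ _ _ _ _.
set mu := grad_estimate x f N [set: 'I_d]%SET Cs [set: 'I_N]%SET w.
set b := B%:R.
have hgam' : gam * L * b ^+ 2 <= 1 := hgam.
have b1 : 1 <= b by rewrite ler1n.
have gb0 : 0 <= gam * b by rewrite mulr_ge0 ?(ltW gam0)//; lra.
have a0 : 0 <= gam * L by rewrite mulr_ge0// ltW.
pose r := gam * L * (b - 1).
have r0 : 0 <= r by rewrite mulr_ge0// subr_ge0.
(* From 4 (b - 1) <= b^2 and gam L b^2 <= 1. This gives both the side condition of [foldl_drift] and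
   the bound (1 + r)^2 <= 2 below. *)
have r4 : r <= 4^-1.
  rewrite /r; have : gam * L * (4 * (b - 1)) <= gam * L * b ^+ 2.
    by rewrite ler_wpM2l//; have := sqr_ge0 (b - 2); lra.
  lra.
(* The deviation of the outer step from the pure step - gam b mu. *)
pose p := w' - w + (gam * b) *: mu.
have pe : enorm p <= gam * b * r * enorm mu.
  rewrite -(ler_pXn2r (n := 2))// ?nnegrE ?enorm_ge0//; last first.
    exact: mulr_ge0 (mulr_ge0 gb0 r0) (enorm_ge0 _).
  (* Every sub-block obeys the same relative bound, so the squared bounds add up to the full norm
     whatever the bijections are. *)
  rewrite exprMn !(sqr_enorm_blocks hQPd) mulr_sumr ler_sum// => q _.
  rewrite mulr_sumr ler_sum// => k _.
  rewrite -exprMn ler_pXn2r// ?nnegrE ?enorm_ge0//; last first.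
    exact: mulr_ge0 (mulr_ge0 gb0 r0) (enorm_ge0 _).
  pose pp := ((sg q)^-1)%g k.
  have := @foldl_drift R _ _
    (fun i : 'I_B => local_grad hQPd x f (obs (pp, js pp q i)) q k)
    L gam (subblock hQPd w q k) (subblock hQPd mu q k) (ltW gam0) L0
    (fun i => local_grad_lip _ _ _) (enum 'I_B).
  rewrite size_enum_ord -/b => /=.
  set u := foldl _ _ _ => -[|_ hp]; first by move: r4; rewrite /r; lra.
  have -> : subblock hQPd p q k = u - subblock hQPd w q k +
      (gam * b) *: subblock hQPd mu q k.
    apply/matrixP => l j; rewrite ord1 !mxE; congr (_ - _ + _).
    by rewrite /w' concat_blocksE.
  by apply: le_trans hp _; rewrite /r -/mu; lra.
have sqr_mu : enorm mu ^+ 2 = \sum_(k in Cs) dF w k 0 ^+ 2.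
  rewrite sqr_enorm [RHS]big_mkcond/=; apply: eq_bigr => k _.
  by rewrite grad_estimate_full; case: ifP => //; rewrite expr0n.
have mu_le : enorm mu <= enorm (dF w).
  rewrite -(ler_pXn2r (n := 2))// ?nnegrE ?enorm_ge0// sqr_mu sqr_enorm.
  rewrite big_mkcond/= ler_sum// => k _; case: ifP => //; rewrite sqr_ge0//.
have dot_mu : inner (dF w)^T mu = \sum_(k in Cs) dF w k 0 ^+ 2.
  rewrite innerE [RHS]big_mkcond/=; apply: eq_bigr => k _.
  by rewrite grad_estimate_full mxE; case: ifP; rewrite ?mulr0// expr2.
have e0 := enorm_ge0 (dF w); have m0 := enorm_ge0 mu.
have w'E : w' = w + (w' - w) by rewrite addrC subrK.
have step : enorm (w' - w) <= gam * b * (1 + r) * enorm (dF w).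
  rewrite (_ : w' - w = p + (- (gam * b)) *: mu); last first.
    by rewrite /p scaleNr addrK.
  apply: le_trans (ler_enormD _ _) _; rewrite enormZ normrN ger0_norm//.
  apply: le_trans (lerD pe (lexx _)) _.
  have -> : gam * b * r * enorm mu + gam * b * enorm mu =
    gam * b * (1 + r) * enorm mu by lra.
  by rewrite ler_wpM2l// mulr_ge0//; lra.
have sq_step : enorm (w' - w) ^+ 2 <= (gam * b * (1 + r) * enorm (dF w)) ^+ 2.
  rewrite ler_pXn2r// nnegrE ?enorm_ge0// mulr_ge0// mulr_ge0//.
  by rewrite addr_ge0.
have inner_p : inner (dF w)^T p <= enorm (dF w) * (gam * b * r * enorm (dF w)).
  apply: le_trans (inner_le_enorm _ _) _; rewrite ler_wpM2l//.
  by apply: le_trans pe _; rewrite ler_wpM2l// mulr_ge0.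
have := objective_taylor w (w' - w); rewrite -w'E ler_norml => /andP[_].
move: inner_p; rewrite {1}/p innerDr innerZr dot_mu.
set e2 := enorm (dF w) ^+ 2.
(* After division by gam b and by gam L, the claim is b - 1 + b (1 + r)^2 / 2 <= b^2. It follows
   from (1 + r)^2 / 2 <= 1 and 2 b - 1 <= b^2. *)
have key : gam * b * r + L / 2 * (gam * b * (1 + r)) ^+ 2 <=
    gam * b * (gam * L * b ^+ 2).
  have -> : L / 2 * (gam * b * (1 + r)) ^+ 2 =
    gam * b * (gam * L * b * ((1 + r) ^+ 2 / 2)) by field.
  rewrite -mulrDr ler_wpM2l//.
  have -> : r + gam * L * b * ((1 + r) ^+ 2 / 2) =
    gam * L * (b - 1 + b * ((1 + r) ^+ 2 / 2)) by rewrite /r; field.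
  rewrite ler_wpM2l//.
  have r2 : (1 + r) ^+ 2 / 2 <= 1 by nra.
  have : b * ((1 + r) ^+ 2 / 2) <= b * 1 by rewrite ler_wpM2l//; lra.
  have := sqr_ge0 (b - 1); lra.
have {}key := ler_wpM2r (sqr_ge0 (enorm (dF w))) key.
have : L / 2 * enorm (w' - w) ^+ 2 <=
    L / 2 * (gam * b * (1 + r) * enorm (dF w)) ^+ 2 by rewrite ler_wpM2l// divr_ge0.
rewrite [(_ * enorm (dF w)) ^+ 2]exprMn -/e2.
have -> : enorm (dF w) * (gam * b * r * enorm (dF w)) = gam * b * r * e2.
  by rewrite /e2; ring.
move: key; rewrite -/e2; lra.
Qed.

End Blocks.
End Problem.

(** * Consequences of strong convexity *)

Section StrongConvexity.
Variables (R : realType) (N d : nat) (x : 'I_N -> 'rV[R]_d) (f : 'I_N -> R -> R).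
Variable L : R.
Hypothesis hf : forall i z, derivable (f i) z 1.
Hypothesis L0 : 0 <= L.
Hypothesis hN : (0 < N)%N.
Hypothesis hLip : forall i (w w' : 'cV[R]_d),
  enorm (grad (loss_at x f i) w - grad (loss_at x f i) w') <= L * enorm (w - w').
Variable xi : R.
Hypotheses (xi0 : 0 < xi) (hconv : strongly_convex xi (objective x f)).
Local Notation F := (objective x f).
Local Notation dF := (objective_grad x f).

(** If the inequality failed by eps > 0, strong convexity at w + a (v - w) and the lower Taylor
    bound would give a eps <= a^2 K. The explicit weight a = eps / (K + eps), chosen instead of a
    limit a -> 0, makes a K < eps, a contradiction. *)
Lemma strongly_convex_tangent w v :
  F w + inner (dF w)^T (v - w) + xi / 2 * enorm (v - w) ^+ 2 <= F v.
Proof.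
set D2 := enorm _ ^+ 2; have D20 : 0 <= D2 := sqr_ge0 _.
set s := inner _ _; rewrite leNgt; apply/negP => hlt.
pose eps := F w + s + xi / 2 * D2 - F v.
have eps0 : 0 < eps by rewrite /eps subr_gt0.
pose K := (L + xi) / 2 * D2.
have K0 : 0 <= K by rewrite mulr_ge0// divr_ge0// addr_ge0// ltW.
have Ke0 : 0 < K + eps by rewrite ltr_wpDl.
pose a := eps / (K + eps).
have a0 : 0 < a by rewrite divr_gt0.
have a1 : a <= 1 by rewrite ler_pdivrMr// mul1r lerDr.
have aK : a * K < eps.
  by rewrite mulrAC ltr_pdivrMr// ltr_pM2l// ltrDl.
have := hconv v w (a := a); rewrite (ltW a0) a1 => /(_ isT).
have -> : a *: v + (1 - a) *: w = w + a *: (v - w).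
  by apply/matrixP => i j; rewrite !mxE; ring.
have := objective_taylor hf hN hLip w (a *: (v - w)).
rewrite ler_norml => /andP[+ _].
rewrite innerZr enormZ exprMn (ger0_norm (ltW a0)) -/s -/D2 => h1 h2.
have : a * eps <= a * (a * K) by rewrite /eps /K; lra.
by rewrite ler_pM2l// leNgt aK.
Qed.

(** The tangent inequality and Cauchy-Schwarz bound the gap by |g| D - xi D^2 / 2 with D = |v - w|;
    completing the square in D finishes. *)
Lemma polyak_lojasiewicz w v : 2 * xi * (F w - F v) <= enorm (dF w) ^+ 2.
Proof.
have h := strongly_convex_tangent w v.
have := inner_le_enorm (dF w) (- (v - w)).
rewrite -scaleN1r innerZr scaleN1r enormN mulN1r => hs.
have := sqr_ge0 (enorm (dF w) - xi * enorm (v - w)).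
have : xi * (F w - F v) <=
    xi * (enorm (dF w) * enorm (v - w) - xi / 2 * enorm (v - w) ^+ 2).
  by rewrite ler_pM2l//; lra.
lra.
Qed.

(** Strong convexity at the midpoint, where minimality bounds the value below by that at [wstar]. *)
Lemma quadratic_growth wstar w :
  (forall v, F wstar <= F v) -> xi / 4 * enorm (w - wstar) ^+ 2 <= F w - F wstar.
Proof.
move=> hmin; have := hconv w wstar (a := 2^-1).
have h := hmin (2^-1 *: w + (1 - 2^-1) *: wstar).
have -> : 0 <= (2^-1 : R) <= 1 by apply/andP; split; lra.
by move=> /(_ isT); lra.
Qed.

End StrongConvexity.

(** * Random variables determined by finitely many draws *)

Definition depends_on (T : Type) (I : choiceType) (V : I -> Type)
    (X : forall i, T -> V i) (J : {fset I}) (U : Type) (Z : T -> U) : Prop :=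
  forall o o', (forall i, i \in J -> X i o = X i o') -> Z o = Z o'.

Section FiniteHistory.
Variables (R : realType) (disp : measure_display) (T : measurableType disp).
Variables (Pr : probability T R) (I : choiceType) (V : I -> finType).
Variable X : forall i, T -> V i.
Hypothesis mX : forall i (A : {set V i}), measurable [set o | X i o \in A].
Variable J : {fset I}.

(** The joint value of the draws in [J] ranges over a finite type, so its fibers cut the sample
    space into finitely many events. A variable depending on [J] is constant on each of them, hence
    a simple function. *)
Definition history (o : T) : {dffun forall i : J, V (val i)} :=
  [ffun i : J => X (val i) o].

Lemma history_eqP o o' :
  history o = history o' <-> (forall i, i \in J -> X i o = X i o').
Proof.
split=> [h i iJ|h]; last by apply/ffunP => i; rewrite !ffunE; exact: h (valP i).
by have := congr1 (fun g : {dffun _} => g [` iJ]%fset) h; rewrite /history !ffunE.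
Qed.

Definition fiber a : set T := history @^-1` [set a].

Lemma fiber_bigcap o :
  fiber (history o) =
  \bigcap_(i in [set` J]) [set o' | X i o' \in [set X i o]%SET].
Proof.
rewrite /fiber; apply/seteqP; split => o' /=.
  by move/history_eqP => h i /= iJ; rewrite inE h.
by move=> h; apply/history_eqP => i iJ; have /= := h i iJ; rewrite inE => /eqP.
Qed.

Lemma fiber_cases a : fiber a = set0 \/ exists o, a = history o.
Proof.
have [->|/set0P[ o <-]] := eqVneq (fiber a) set0; first by left.
by right; exists o.
Qed.

Lemma measurable_fiber a : measurable (fiber a).
Proof.
case: (fiber_cases a) => [->//|[ o ->]]; rewrite fiber_bigcap.
by apply: fin_bigcap_measurable => // i _; exact: mX.
Qed.

(** A nonempty fiber is a cylinder event. Mutual independence is applied to [J] and to [J] with [i0]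
    added, and the two products differ by the factor of [i0]. *)
Lemma fiber_indep a i0 (A : {set V i0}) :
  mutually_independent Pr X -> i0 \notin J ->
  Pr (fiber a `&` [set o | X i0 o \in A]) =
  (Pr (fiber a) * Pr [set o | X i0 o \in A])%E.
Proof.
move=> hind i0J; case: (fiber_cases a) => [->|[ o ->]].
  by rewrite set0I measure0 mul0e.
pose A0 i : {set V i} := [set X i o]%SET.
have m1 := measurable_fiber (history o); have m2 := mX A.
have fin_eq (u v : \bar R) : u \is a fin_num -> v \is a fin_num ->
    fine u = fine v -> u = v.
  by move=> u_fin v_fin uv; rewrite -(fineK u_fin) -(fineK v_fin) uv.
apply: fin_eq; rewrite ?fin_numM ?fin_num_measure//; first exact: measurableI.
rewrite fineM ?fin_num_measure//.
(* The family prescribes the singleton values of [o] on [J] and the set [A] at [i0]. *)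
have := hind (i0 |` J)%fset (dfwith A0 i0 A).
rewrite big_fsetU1//= dfwithin => h.
rewrite fiber_bigcap (hind J A0) mulrC.
transitivity (fine (Pr (\bigcap_(i in [set` (i0 |` J)%fset])
   [set o' | X i o' \in dfwith A0 i0 A i]))).
  congr (fine (Pr _)); apply/seteqP; split => o' /=.
    move=> [h1 h2] i /=; rewrite in_fset1U => /orP[/eqP ->|iJ].
      by rewrite dfwithin.
    by rewrite dfwithout ?h1//; apply: contraNneq i0J => ->.
  move=> h1; split; last first.
    by have := h1 i0; rewrite /= dfwithin; apply; rewrite in_fset1U eqxx.
  move=> i /= iJ; have := h1 i; rewrite /= in_fset1U iJ orbT dfwithout; last first.
    by apply: contraNneq i0J => ->.
  by apply.
rewrite h; congr (_ * _); apply: eq_big_seq => i iJ.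
by rewrite dfwithout//; apply: contraNneq i0J => ->.
Qed.

Section DependentVariable.
Variable Z : T -> R.
Hypotheses (Z0 : forall o, 0 <= Z o) (hZ : depends_on X J Z).

(** The constant value of [Z] on a fiber. The default 0 is taken on tuples never attained, whose
    fibers are empty and contribute nothing to the sums. *)
Definition history_value (a : {dffun forall i : J, V (val i)}) : R :=
  if pselect (exists o, history o = a) is left e then Z (projT1 (cid e)) else 0.

Lemma history_value_ge0 a : 0 <= history_value a.
Proof. by rewrite /history_value; case: pselect. Qed.

Lemma history_valueK o : history_value (history o) = Z o.
Proof.
rewrite /history_value; case: pselect => [e|[]]; last by exists o.
by apply: hZ; apply/history_eqP; exact: projT2 (cid e).
Qed.

Lemma mul_indic_history (E : set T) o :
  Z o * \1_E o = \sum_a history_value a * \1_(fiber a `&` E) o.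
Proof.
rewrite (bigD1 (history o))//= big1 => [|a ao].
  by rewrite addr0 history_valueK !indicE in_setI (_ : o \in fiber _) ?inE.
rewrite indicE in_setI (_ : (o \in fiber a) = false) ?mulr0//.
by apply/negbTE; apply: contra ao; rewrite inE => ->.
Qed.

Lemma measurable_depends_on : measurable_fun [set: T] Z.
Proof.
rewrite (_ : Z = fun o => \sum_a history_value a * \1_(fiber a `&` setT) o).
  apply: measurable_sum => a; apply: measurable_funM => //.
  by rewrite setIT; apply: measurable_indic; exact: measurable_fiber.
by apply: funext => o; rewrite -mul_indic_history indicT mulr1.
Qed.

Lemma integral_mul_indic (E : set T) : measurable E ->
  (\int[Pr]_o (Z o * \1_E o)%:E =
   \sum_a (history_value a)%:E * Pr (fiber a `&` E))%E.
Proof.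
move=> mE.
have mfE a : measurable (fiber a `&` E).
  by apply: measurableI => //; exact: measurable_fiber.
under eq_integral => o _ do rewrite mul_indic_history -sumEFin.
rewrite ge0_integral_sum//.
- apply: eq_bigr => a _; under eq_integral => o _ do rewrite EFinM.
  rewrite ge0_integralZl_EFin//; last exact: history_value_ge0.
    by rewrite integral_indic// setIT.
  by apply/measurable_EFinP; exact: measurable_indic.
- move=> a; apply/measurable_EFinP; apply: measurable_funM => //.
- by move=> a o _; rewrite lee_fin mulr_ge0// history_value_ge0.
Qed.

Lemma integral_depends_on :
  (\int[Pr]_o (Z o)%:E = \sum_a (history_value a)%:E * Pr (fiber a))%E.
Proof.
rewrite -[RHS](eq_bigr _ (fun a _ => congr1 (fun E => _ * Pr E)%E (setIT _))).
rewrite -integral_mul_indic//.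
by apply: eq_integral => o _; rewrite indicT mulr1.
Qed.

Lemma integral_depends_on_fin_num : (\int[Pr]_o (Z o)%:E)%E \is a fin_num.
Proof.
rewrite integral_depends_on; apply/sum_fin_numP => a _ _.
by rewrite fin_numM// fin_num_measure//; exact: measurable_fiber.
Qed.

(** Both integrals are finite sums over fibers, and independence factors each term. *)
Lemma integral_mul_indep i0 (A : {set V i0}) :
  mutually_independent Pr X -> i0 \notin J ->
  (\int[Pr]_o (Z o * \1_[set o | X i0 o \in A] o)%:E =
   \int[Pr]_o (Z o)%:E * Pr [set o | X i0 o \in A])%E.
Proof.
move=> hind i0J; rewrite integral_mul_indic; last exact: mX.
rewrite integral_depends_on ge0_sume_distrl; last first.
  by move=> a _; rewrite mule_ge0// lee_fin history_value_ge0.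
by apply: eq_bigr => a _; rewrite fiber_indep// muleA.
Qed.

End DependentVariable.
End FiniteHistory.

(** * Almost sure convergence and counting of samples *)

Section FiniteSampling.
Variables (R : realType) (disp : measure_display) (T : measurableType disp).
Variable Pr : probability T R.

Lemma ae_of_probability1 (A : set T) : measurable A -> Pr A = 1%:E ->
  {ae Pr, forall o, A o}.
Proof.
move=> mA PA; exists (~` A); split => //; first exact: measurableC.
by rewrite [LHS]probability_setC// PA subee.
Qed.

Lemma probability_in_sum (V : finType) (Y : T -> V) (A : {set V}) :
  (forall A : {set V}, measurable [set o | Y o \in A]) ->
  Pr [set o | Y o \in A] = (\sum_(v in A) Pr [set o | Y o = v])%E.
Proof.
move=> mY.
have mv v : measurable [set o | Y o = v].
  rewrite (_ : [set o | Y o = v] = [set o | Y o \in [set v]%SET])//.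
  by apply/seteqP; split => o /=; rewrite inE => /eqP.
rewrite (_ : [set o | Y o \in A] =
    \bigcup_(v in [set` A]) [set o | Y o = v]); last first.
  apply/seteqP; split => o /=; first by move=> h; exists (Y o).
  by move=> [v /= vA ->].
rewrite measure_fin_bigcup//; last first.
  apply/trivIsetP => u v _ _ uv; apply/seteqP; split => o //= [->] /eqP.
  exact/negP.
rewrite (_ : [set` A] = [set` enum A]) -?fsbig_seq ?enum_uniq ?big_enum//.
by apply/seteqP; split => v /=; rewrite mem_enum.
Qed.

(** Exchanging series and integral of nonnegative terms bounds the expectation of the whole series
    by [M]. The series is therefore finite almost surely, and its terms tend to 0. *)
Lemma ae_cvg0_of_summable_expectation (Y : nat -> T -> R) (M : R) :
  (forall n o, 0 <= Y n o) -> (forall n, measurable_fun [set: T] (Y n)) ->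
  (forall n, (\sum_(0 <= i < n) \int[Pr]_o (Y i o)%:E <= M%:E)%E) ->
  {ae Pr, forall o, Y n o @[n --> \oo] --> 0}.
Proof.
move=> Y0 mY hM.
have mEY n : measurable_fun [set: T] (fun o => (Y n o)%:E) by exact/measurable_EFinP.
have EY0 n o : (0 <= (Y n o)%:E)%E by rewrite lee_fin.
pose S o := (\sum_(0 <= n <oo) (Y n o)%:E)%E.
have mS : measurable_fun [set: T] S by apply: ge0_emeasurable_sum.
have S0 o : (0 <= S o)%E by apply: nneseries_ge0.
have iS : Pr.-integrable [set: T] S.
  apply/integrableP; split => //.
  under eq_integral => o _ do rewrite gee0_abs//.
  rewrite integral_nneseries//; apply: (@le_lt_trans _ _ M%:E); last exact: ltry.
  apply: lime_le; last by apply: nearW => n; exact: hM.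
  by apply: is_cvg_nneseries => n _ _; exact: integral_ge0.
apply: filterS (integrable_ae measurableT iS) => o /(_ I) So.
apply: cvg_series_cvg_0; apply: nondecreasing_is_cvgn.
  by apply: nondecreasing_series => n _ _; exact: Y0.
exists (fine (S o)) => _ [n _ <-].
rewrite -lee_fin fineK// /series/= -sumEFin.
by apply: nneseries_lim_ge => i _ _; exact: EY0.
Qed.

End FiniteSampling.

(** The sets avoiding [k] are the [c]-subsets of the other d - 1 points. Subtracting them by
    Pascal's rule leaves C(d-1, c-1), and d C(d-1, c-1) = c C(d, c). *)
Lemma card_draws_mem (d c : nat) (k : 'I_d) :
  (d * #|[set S : {set 'I_d} | (#|S| == c) && (k \in S)]%SET|)%N = (c * 'C(d, c))%N.
Proof.
have h1 : #|[set S : {set 'I_d} | #|S| == c]%SET| = 'C(d, c).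
  by rewrite card_draws card_ord.
have h2 :
    #|[set S : {set 'I_d} | S \subset [set~ k]%SET & #|S| == c]%SET| = 'C(d.-1, c).
  by rewrite cards_draws cardsC1 card_ord.
have h : (#|[set S : {set 'I_d} | (#|S| == c) && (k \in S)]%SET| + 'C(d.-1, c))%N =
    'C(d, c).
  rewrite -h1 -h2 -(cardsID [set S : {set 'I_d} | k \in S]%SET
    [set S : {set 'I_d} | #|S| == c]%SET).
  congr (_ + _)%N; apply: eq_card => S; rewrite !inE//.
  by rewrite -finset.disjoints_subset disjoint_sym disjoints1.
clear h1 h2; case: d k h => [[]//|d] k; case: c => [|c] h.
  by move: h; rewrite !bin0 addn1 => -[->]; rewrite muln0.
by move: h; rewrite binS addnC => /addnI ->; exact: mul_bin_diag.
Qed.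

(** * The finite set of draws preceding an iteration *)

Section Draws.
Variables (P Q B : nat).

Definition draw_time (i : draw P Q B) : nat :=
  match i with
  | CoordDraw t | ObsDraw t | PermDraw t _ | PickDraw t _ _ _ => t
  end.

Definition draws_at (t : nat) : seq (draw P Q B) :=
  CoordDraw t :: ObsDraw t :: [seq PermDraw t q | q <- enum 'I_Q] ++
  [seq PickDraw t a.1.1 a.1.2 a.2 | a <- enum {: 'I_P * 'I_Q * 'I_B}].

Definition draws_before (t : nat) : {fset draw P Q B} :=
  seq_fset tt (flatten [seq draws_at u | u <- iota 0 t]).

Lemma mem_draws_before t i : (i \in draws_before t) = (draw_time i < t)%N.
Proof.
rewrite seq_fsetE; apply/flatten_mapP/idP => [[u]|lt].
  rewrite mem_iota add0n /= => ut.
  rewrite /draws_at !inE mem_cat => /or3P[/eqP ->//|/eqP ->//|].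
  by move=> /orP[/mapP[q _ ->]//|/mapP[q _ ->]].
exists (draw_time i); first by rewrite mem_iota.
rewrite /draws_at !inE mem_cat; case: i lt => [u|u|u q|u p q j] _ /=.
- by rewrite eqxx.
- by rewrite eqxx orbT.
- by rewrite (map_f (PermDraw u)) ?mem_enum// !orbT.
- apply/orP; right; apply/orP; right; apply/orP; right.
  by apply/mapP; exists (p, q, j); rewrite ?mem_enum.
Qed.

End Draws.

(** * Iterates as functions of past draws *)

Section Trajectory.
Variables (R : realType) (N d P Q B : nat) (T : Type) (hQPd : (Q * P %| d)%N).
Variables (obs : 'I_P * 'I_(N %/ P) -> 'I_N).
Variables (x : 'I_N -> 'rV[R]_d) (f : 'I_N -> R -> R) (gam : nat -> R).
Variables (s : nat -> nat) (X : forall i : draw P Q B, T -> draw_val N d i).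

Local Notation w := (sodda hQPd obs x f gam s X).

Lemma soddaS t o : w t.+1 o =
  sodda_step hQPd obs x f (gam t.+1) (s t)
    (X (CoordDraw t) o).1 (X (CoordDraw t) o).2 (X (ObsDraw t) o)
    (fun q => X (PermDraw t q) o) (fun p q i => X (PickDraw t p q i) o) (w t o).
Proof. by []. Qed.

Lemma sodda_depends_on t :
  depends_on (V := fun i => draw_val N d i) X (draws_before P Q B t) (w t).
Proof.
elim: t => [|t IHt] o o' h; first by [].
have hX i : draw_time i = t -> X i o = X i o'.
  by move=> it; apply: h; rewrite mem_draws_before it.
rewrite !soddaS (IHt o o'); last first.
  by move=> i; rewrite mem_draws_before => it; apply: h;
    rewrite mem_draws_before ltnW.
rewrite (hX (CoordDraw t) erefl) (hX (ObsDraw t) erefl).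
have -> : (fun q => X (PermDraw t q) o) = (fun q => X (PermDraw t q) o').
  by apply: funext => q; exact: (hX (PermDraw t q) erefl).
pose pick o : 'I_P -> 'I_Q -> 'I_B -> 'I_(N %/ P) :=
  fun p q i => X (PickDraw t p q i) o.
suff pick_eq : pick o = pick o'.
  by rewrite -[LHS]/(sodda_step _ _ _ _ _ _ _ _ _ _ (pick o) _) pick_eq.
apply: funext => p; apply: funext => q; apply: funext => i.
exact: (hX (PickDraw t p q i) erefl).
Qed.

End Trajectory.

(** * Laws of the full batches and of the coordinate mask *)

Section Sampling.
Variables (R : realType) (disp : measure_display) (T : measurableType disp).
Variables (Pr : probability T R) (N d P Q B : nat) (b c s : nat -> nat).
Variable X : forall i : draw P Q B, T -> draw_val N d i.
Hypothesis hX : sodda_sampling Pr b c s X.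
Hypotheses (hbd : forall t, b t = d) (hsN : forall t, s t = N).
Hypothesis hcb : forall t, (c t <= b t)%N.

Lemma measurable_draw i v : measurable [set o | X i o = v].
Proof.
case: hX => mX _ _ _ _.
rewrite (_ : mkset _ = [set o | X i o \in [set v]%SET])//.
by apply/seteqP; split => o /=; rewrite inE => /eqP.
Qed.

Lemma probability_all_coords t :
  Pr [set o | (X (CoordDraw t) o).1 = [set: 'I_d]%SET] = 1%:E.
Proof.
case: hX => _ _ [hC _] _ _.
by rewrite hC ?cardsT ?card_ord ?hbd// binn invr1.
Qed.

Lemma ae_all_coords_obs t : {ae Pr, forall o,
  (X (CoordDraw t) o).1 = [set: 'I_d]%SET /\ X (ObsDraw t) o = [set: 'I_N]%SET}.
Proof.
case: (hX) => mX _ _ hD _.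
have h1 : {ae Pr, forall o, (X (CoordDraw t) o).1 = [set: 'I_d]%SET}.
  apply: ae_of_probability1 (probability_all_coords t).
  rewrite (_ : mkset _ = [set o | X (CoordDraw t) o \in
    [set p : {set 'I_d} * {set 'I_d} | p.1 == [set: 'I_d]%SET]%SET]) ?mX//.
  by apply/seteqP; split => o /=; rewrite inE => /eqP.
have h2 : {ae Pr, forall o, X (ObsDraw t) o = [set: 'I_N]%SET}.
  apply: ae_of_probability1; first exact: measurable_draw.
  by rewrite hD ?cardsT ?card_ord ?hsN// binn invr1.
by apply: filterS2 h1 h2.
Qed.

Definition selects (k : 'I_d) : {set {set 'I_d} * {set 'I_d}} :=
  [set p : {set 'I_d} * {set 'I_d} | k \in p.2]%SET.

(** Restricting to pairs whose first set is everything and whose second has exactly [c t] elements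
    gives an event inside [selects k]. Each such pair has probability 1 / C(d, c t), and
    [card_draws_mem] counts them. *)
Lemma probability_selects_ge t k :
  (((c t)%:R / d%:R)%:E <= Pr [set o | X (CoordDraw t) o \in selects k])%E.
Proof.
case: (hX) => mX _ [_ hC] _ _.
have ctd : (c t <= d)%N by rewrite -(hbd t).
have d0 : (0 < d)%N by case: d k => [[]//|].
have C0 : (0 < 'C(d, c t))%N by rewrite bin_gt0.
pose CS := [set S : {set 'I_d} | (#|S| == c t) && (k \in S)]%SET.
pose A := [set p : {set 'I_d} * {set 'I_d} |
  p \in finset.setX [set [set: 'I_d]%SET]%SET CS]%SET.
apply: (@le_trans _ _ (Pr [set o | X (CoordDraw t) o \in A])); last first.
  apply: le_measure; rewrite ?inE; try exact: mX.
  move=> o /=; rewrite /A /selects !inE.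
  by case/andP => _ /andP[].
rewrite (probability_in_sum Pr (Y := X (CoordDraw t)))//.
rewrite (eq_bigr (fun=> ('C(d, c t)%:R^-1)%:E)); last first.
  move=> [S S']; rewrite /A !inE/= => /andP[/eqP -> /andP[/eqP hS' _]].
  rewrite hC ?hbd ?cardsT ?card_ord ?finset.subsetT//.
  by rewrite probability_all_coords mul1e.
rewrite sumEFin sumr_const lee_fin.
rewrite (_ : #|A| = #|CS|); last first.
  rewrite -[RHS]mul1n -(cards1 [set: 'I_d]%SET) -cardsX.
  by apply: eq_card => p; rewrite inE.
rewrite -[_^-1 *+ _]mulr_natr -(ler_pM2l (_ : 0 < d%:R * 'C(d, c t)%:R)); last first.
  by rewrite mulr_gt0 ?ltr0n.
have := congr1 (fun n => n%:R : R) (card_draws_mem (c t) k).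
rewrite !natrM -/CS => h.
have dn0 : d%:R != 0 :> R by rewrite pnatr_eq0 -lt0n.
have Cn0 : 'C(d, c t)%:R != 0 :> R by rewrite pnatr_eq0 -lt0n.
move: h dn0 Cn0; move: #|CS|%:R ('C(d, c t)%:R) (d%:R) ((c t)%:R).
move=> u C D r h D_neq0 C_neq0.
rewrite le_eqVlt; apply/orP; left; apply/eqP.
transitivity (D * u); last by field.
by rewrite h; field.
Qed.

End Sampling.

(** * Descent of the expected optimality gap *)

Section ExpectedDescent.
Variables (R : realType) (N d P Q B : nat).
Hypotheses (hN : (0 < N)%N) (hB : (0 < B)%N).
Variables (hQPd : (Q * P %| d)%N) (obs : 'I_P * 'I_(N %/ P) -> 'I_N).
Variables (x : 'I_N -> 'rV[R]_d) (f : 'I_N -> R -> R).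
Hypothesis hf : forall i z, derivable (f i) z 1.
Variables (wstar : 'cV[R]_d) (b c s : nat -> nat) (gam : nat -> R).
Hypothesis hmin : forall v, objective x f wstar <= objective x f v.
Hypothesis hcb : forall t, (c t <= b t)%N.
Variables (disp : measure_display) (T : measurableType disp) (Pr : probability T R).
Variable X : forall i : draw P Q B, T -> draw_val N d i.
Hypothesis hX : sodda_sampling Pr b c s X.
Variables (xi L gamma rho : R).
Hypotheses (xi0 : 0 < xi) (hconv : strongly_convex xi (objective x f)).
Hypothesis L0 : 0 <= L.
Hypothesis hLip : forall i (w w' : 'cV[R]_d),
  enorm (grad (loss_at x f i) w - grad (loss_at x f i) w') <= L * enorm (w - w').
Hypotheses (hbd : forall t, b t = d) (hsN : forall t, s t = N).
Hypotheses (gamma0 : 0 < gamma) (hconst : forall t, (1 <= t)%N -> gam t = gamma).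
Hypothesis hrho : forall t, rho <= (c t)%:R / d%:R.
Hypotheses (rho_lt : gamma * L * B%:R ^+ 2 < rho) (rho1 : rho <= 1).

Local Notation w := (sodda hQPd obs x f gam s X).
Local Notation F := (objective x f).
Local Notation dF := (objective_grad x f).

Definition gap t o := F (w t o) - F wstar.

Lemma gap_ge0 t o : 0 <= gap t o.
Proof. by rewrite subr_ge0. Qed.

Lemma comp_sodda_depends_on U (h : 'cV[R]_d -> U) t :
  depends_on (V := fun i => draw_val N d i) X (draws_before P Q B t)
    (fun o => h (w t o)).
Proof. by move=> o o' oo'; congr (h _); exact: sodda_depends_on. Qed.

Lemma measurable_comp_sodda (h : 'cV[R]_d -> R) t :
  measurable_fun [set: T] (fun o => h (w t o)).
Proof.
case: (hX) => mX _ _ _ _.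
exact: (measurable_depends_on mX (@comp_sodda_depends_on _ h t)).
Qed.

Lemma integral_comp_sodda_fin_num (h : 'cV[R]_d -> R) t :
  (forall v, 0 <= h v) -> (\int[Pr]_o (h (w t o))%:E)%E \is a fin_num.
Proof.
move=> h0; case: (hX) => mX _ _ _ _.
exact: (integral_depends_on_fin_num Pr mX (fun o => h0 (w t o))
  (@comp_sodda_depends_on _ h t)).
Qed.

(** The deterministic descent holds on the almost sure event that both batches are full. The mask
    becomes an indicator and every term is kept nonnegative, so that both sides can be integrated
    term by term. *)
Lemma ae_step_descent t : {ae Pr, forall o,
  gap t.+1 o + \sum_k gamma * B%:R *
    (dF (w t o) k 0 ^+ 2 * \1_[set o | X (CoordDraw t) o \in selects k] o) <=
  gap t o + \sum_k gamma * B%:R * (gamma * L * B%:R ^+ 2) * dF (w t o) k 0 ^+ 2}.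
Proof.
apply: filterS (ae_all_coords_obs hX hbd hsN t) => o [hC hD].
rewrite /gap soddaS hC hD hconst// hsN -!mulr_sumr -sqr_enorm.
have := sodda_step_descent hf L0 hN hLip hQPd obs hB gamma0
  (ltW (lt_le_trans rho_lt rho1)) (X (CoordDraw t) o).2
  (fun q => X (PermDraw t q) o) (fun p q i => X (PickDraw t p q i) o) (w t o).
rewrite [in X in X <= _ -> _]big_mkcond/=.
under eq_bigr => k _.
  rewrite (_ : (if _ then _ else _) = dF (w t o) k 0 ^+ 2 *
    \1_[set o | X (CoordDraw t) o \in selects k] o); last first.
    rewrite indicE /selects; set i := (o \in _).
    have -> : i = (k \in (X (CoordDraw t) o).2).
      by apply/idP/idP; rewrite /i !inE /= inE.
    by case: ifP => _; rewrite ?mulr1 ?mulr0.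
  over.
by move=> h; rewrite -addrAC [leRHS]addrAC lerD2r.
Qed.

(** After integration, independence of the mask from the current iterate bounds the masked gradient
    below by [rho] times the full one. The surplus [rho - eta] is positive, and the
    Polyak-Lojasiewicz inequality converts it into a multiple of the current gap. *)
Lemma expected_gap_descent t :
  (\int[Pr]_o (gap t.+1 o)%:E +
   (2 * xi * (gamma * B%:R * (rho - gamma * L * B%:R ^+ 2)))%:E *
     \int[Pr]_o (gap t o)%:E <= \int[Pr]_o (gap t o)%:E)%E.
Proof.
case: (hX) => mX hind _ _ _.
have B0 : 0 < B%:R :> R by rewrite ltr0n.
have gB0 : 0 < gamma * B%:R by rewrite mulr_gt0.
set eta := gamma * L * B%:R ^+ 2.
have eta0 : 0 <= eta by rewrite mulr_ge0 ?sqr_ge0// mulr_ge0// ltW.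
have gE u : (\int[Pr]_o (gap u o)%:E)%E \is a fin_num.
  by apply: (integral_comp_sodda_fin_num u (h := fun v => F v - F wstar)) => v;
    rewrite subr_ge0.
have mgap u : measurable_fun [set: T] (fun o => (gap u o)%:E).
  apply/measurable_EFinP.
  exact: (measurable_comp_sodda (fun v => F v - F wstar)).
have gap0 u o : (0 <= (gap u o)%:E)%E by rewrite lee_fin gap_ge0.
have dE k : (\int[Pr]_o (dF (w t o) k 0 ^+ 2)%:E)%E \is a fin_num.
  by apply: (integral_comp_sodda_fin_num t (h := fun v => dF v k 0 ^+ 2)) => v;
    rewrite sqr_ge0.
have mdF k : measurable_fun [set: T] (fun o => dF (w t o) k 0 ^+ 2).
  exact: (measurable_comp_sodda (fun v => dF v k 0 ^+ 2)).
pose h k := fine (\int[Pr]_o (dF (w t o) k 0 ^+ 2)%:E)%E.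
pose e u := fine (\int[Pr]_o (gap u o)%:E)%E.
have he k : (\int[Pr]_o (dF (w t o) k 0 ^+ 2)%:E)%E = (h k)%:E by rewrite fineK.
have fe u : (\int[Pr]_o (gap u o)%:E)%E = (e u)%:E by rewrite fineK.
have int_sum (a : R) (Y : 'I_d -> T -> R) : 0 <= a ->
    (forall k, measurable_fun [set: T] (Y k)) -> (forall k o, 0 <= Y k o) ->
    (\int[Pr]_o (\sum_k a * Y k o)%:E = \sum_k a%:E * \int[Pr]_o (Y k o)%:E)%E.
  move=> a0 mY Y0; under eq_integral => o _ do rewrite -sumEFin.
  rewrite ge0_integral_sum//.
  - apply: eq_bigr => k _; under eq_integral => o _ do rewrite EFinM.
    rewrite ge0_integralZl_EFin//; first by move=> o _; rewrite lee_fin.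
    exact/measurable_EFinP.
  - by move=> k; apply/measurable_EFinP; apply: measurable_funM.
  - by move=> k o _; rewrite lee_fin mulr_ge0.
have mind k : measurable_fun [set: T] (fun o => dF (w t o) k 0 ^+ 2 *
    \1_[set o | X (CoordDraw t) o \in selects k] o).
  by apply: measurable_funM => //; apply: measurable_indic; exact: mX.
have msum (a : R) (Y : 'I_d -> T -> R) : 0 <= a ->
    (forall k, measurable_fun [set: T] (Y k)) ->
    measurable_fun [set: T] (fun o => (\sum_k a * Y k o)%:E).
  move=> a0 mY; apply/measurable_EFinP; apply: measurable_sum => k.
  exact: measurable_funM.
have sum0 (a : R) (Y : 'I_d -> T -> R) : 0 <= a -> (forall k o, 0 <= Y k o) ->
    forall o, (0 <= (\sum_k a * Y k o)%:E)%E.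
  by move=> a0 Y0 o; rewrite lee_fin sumr_ge0// => k _; rewrite mulr_ge0.
have sq0 k o : 0 <= dF (w t o) k 0 ^+ 2 by exact: sqr_ge0.
have ind0 k o : 0 <= dF (w t o) k 0 ^+ 2 *
    \1_[set o | X (CoordDraw t) o \in selects k] o.
  by rewrite mulr_ge0 ?sqr_ge0.
have step : e t.+1 + gamma * B%:R * rho * \sum_k h k <=
    e t + gamma * B%:R * eta * \sum_k h k.
  have a1 : 0 <= gamma * B%:R by exact: ltW.
  have a2 : 0 <= gamma * B%:R * eta by rewrite mulr_ge0.
  rewrite -lee_fin.
  have := ae_ge0_le_integral (mu := Pr) measurableT
    (f1 := fun o => ((gap t.+1 o)%:E + (\sum_k gamma * B%:R * (dF (w t o) k 0 ^+ 2 *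
      \1_[set o | X (CoordDraw t) o \in selects k] o))%:E)%E)
    (f2 := fun o => ((gap t o)%:E + (\sum_k gamma * B%:R * eta *
      dF (w t o) k 0 ^+ 2)%:E)%E).
  rewrite !ge0_integralD//; try exact: msum.
  rewrite !int_sum//.
  have H1 o : [set: T] o -> (0 <= (gap t.+1 o)%:E + (\sum_k gamma * B%:R *
      (dF (w t o) k 0 ^+ 2 * \1_[set o | X (CoordDraw t) o \in selects k] o))%:E)%E.
    by move=> _; rewrite adde_ge0//; exact: (sum0 _ _ a1 ind0).
  have H2 o : [set: T] o -> (0 <= (gap t o)%:E +
      (\sum_k gamma * B%:R * eta * dF (w t o) k 0 ^+ 2)%:E)%E.
    move=> _; rewrite adde_ge0//; exact: (sum0 _ _ a2 sq0).
  move=> /(_ H1) /(_ (emeasurable_funD (mgap _) (msum _ _ a1 mind))).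
  move=> /(_ H2) /(_ (emeasurable_funD (mgap _) (msum _ _ a2 mdF))) main.
  rewrite EFinD EFinD -!fe; apply: le_trans (le_trans _ (main _)) _.
  - rewrite leeD2l// mulr_sumr -sumEFin lee_sum// => k _.
    rewrite -mulrA EFinM lee_pmul2l ?lte_fin ?fin_numE//.
    (* The mask drawn at time [t] is not among the draws before [t], which determine the iterate. *)
    rewrite (integral_mul_indep mX _
      (@comp_sodda_depends_on _ (fun v => dF v k 0 ^+ 2) t))//.
    + rewrite EFinM -he muleC lee_wpmul2l//.
        by apply: integral_ge0 => o _; rewrite lee_fin.
      by apply: le_trans (probability_selects_ge hX hbd hcb t k); rewrite lee_fin.
    + by rewrite mem_draws_before ltnn.
  - by apply: filterS (ae_step_descent t) => o h' _; rewrite -!EFinD lee_fin.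
  - by rewrite mulr_sumr -sumEFin; under eq_bigr => k _ do rewrite he -EFinM.
  - by move=> o _; exact: (sum0 _ _ a2 sq0).
  - by move=> o _; exact: (sum0 _ _ a1 ind0).
have pl : 2 * xi * e t <= \sum_k h k.
  rewrite -lee_fin EFinM -fe -sumEFin.
  under eq_bigr => k _ do rewrite -he.
  have xi20 : 0 <= 2 * xi by rewrite mulr_ge0// ltW.
  rewrite -ge0_integralZl_EFin//.
  have -> : (\sum_k \int[Pr]_o (dF (w t o) k 0 ^+ 2)%:E =
      \int[Pr]_o (\sum_k 1 * dF (w t o) k 0 ^+ 2)%:E)%E.
    by rewrite int_sum//; apply: eq_bigr => k _; rewrite mul1e.
  apply: ge0_le_integral => //.
  - by move=> o _; rewrite -EFinM lee_fin mulr_ge0// gap_ge0.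
  - by apply: measurable_funeM.
  - by apply: msum.
  move=> o _; rewrite -EFinM lee_fin; under eq_bigr => k _ do rewrite mul1r.
  by rewrite -sqr_enorm; apply: (polyak_lojasiewicz hf L0 hN hLip).
rewrite !fe -EFinM -EFinD lee_fin.
have : gamma * B%:R * (rho - eta) * (2 * xi * e t) <=
  gamma * B%:R * (rho - eta) * \sum_k h k.
  by rewrite ler_wpM2l// mulr_ge0 ?(ltW gB0)// subr_ge0 ltW.
lra.
Qed.

End ExpectedDescent.

(** * From the learning-rate threshold to the descent condition *)

Lemma gamma2_rate (R : realType) (B Q P d cmin : nat) (L gamma : R) :
  (0 < B)%N -> (0 < Q)%N -> (0 < P)%N -> 1 <= L -> 0 < gamma ->
  gamma < gamma2 B Q P d cmin L -> gamma * L * B%:R ^+ 2 < cmin%:R / d%:R.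
Proof.
move=> B0 Q0 P0 L1 g0; rewrite /gamma2.
set bB := _ + L * _; set C := _ * L ^+ 3 * _ * _; set A := _ / _ => hg.
have b1 : 1 <= B%:R :> R by rewrite ler1n.
have q1 : 1 <= Q%:R :> R by rewrite ler1n.
have p1 : 1 <= P%:R :> R by rewrite ler1n.
have L0 : 0 < L by exact: lt_le_trans ltr01 L1.
have A0 : 0 <= A by rewrite divr_ge0.
(* Since Q P >= 1, bB >= (B - 1) B L + L B = L B^2. *)
have bB_ge : L * B%:R ^+ 2 <= bB.
  have h : 0 <= (B%:R - 1) * B%:R * L by rewrite !mulr_ge0 ?subr_ge0// ltW.
  have qp1 : 1 <= Q%:R * P%:R :> R by rewrite mulr_ege1.
  have := ler_wpM2l h qp1; rewrite /bB; lra.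
have bB0 : 0 < bB by apply: lt_le_trans bB_ge; rewrite mulr_gt0// exprn_gt0// ltr0n.
have C0 : 0 < C.
  rewrite /C !mulr_gt0 ?exprn_gt0 ?ltr0n// ltr_wpDr//.
  by rewrite !mulr_ge0 ?exprn_ge0// ltW.
apply: lt_le_trans (rate_bound_le A0 bB0 C0).
rewrite -mulrA mulrC; apply: (@le_lt_trans _ _ (bB * gamma)).
  by rewrite ler_wpM2r// ltW.
by rewrite ltr_pM2l.
Qed.

(** * Almost sure convergence of the iterates *)

Theorem theorem8 (R : realType)
    (N d P Q B : nat)
    (hN : (0 < N)%N) (hd : (0 < d)%N) (hP : (0 < P)%N) (hQ : (0 < Q)%N)
    (hB : (0 < B)%N)
    (hPN : (P %| N)%N) (hQPd : (Q * P %| d)%N)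
    (obs : 'I_P * 'I_(N %/ P) -> 'I_N) (hobs : bijective obs)
    (x : 'I_N -> 'rV[R]_d) (f : 'I_N -> R -> R)
    (hf : forall i z, derivable (f i) z 1)
    (wstar : 'cV[R]_d) (hwstar : unique_minimizer (objective x f) wstar)
    (b c s : nat -> nat) (gam : nat -> R)
    (hc : forall t, (1 <= c t <= b t)%N) (hb : forall t, (b t <= d)%N)
    (hs : forall t, (1 <= s t <= N)%N)
    (hgam : forall t, (1 <= t)%N -> 0 < gam t)
    (disp : measure_display) (T : measurableType disp) (Pr : probability T R)
    (X : forall i : draw P Q B, T -> draw_val N d i)
    (hX : sodda_sampling Pr b c s X)
    (xi : R) (hxi : 0 < xi) (hconv : strongly_convex xi (objective x f))
    (L : R) (hL : 1 <= L)
    (hLip : forall i (w w' : 'cV[R]_d),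
       enorm (grad (loss_at x f i) w - grad (loss_at x f i) w') <=
         L * enorm (w - w'))
    (G : R)
    (hG : {ae Pr, forall o, forall t,
       let w := sodda hQPd obs x f gam s X t o in
       (N%:R - 1)^-1 * \sum_(j < N) (enorm (grad (loss_at x f j) w) ^+ 2
                                     - enorm (grad (objective x f) w) ^+ 2)
         <= G ^+ 2})
    (M2 : R)
    (hM2 : {ae Pr, forall o, forall t,
       enorm (sodda hQPd obs x f gam s X t o) <= M2 / 2%:R})
    (hM2star : enorm wstar <= M2 / 2%:R)
    (hbd : forall t, b t = d) (hsN : forall t, s t = N)
    (gamma : R) (hconst : forall t, (1 <= t)%N -> gam t = gamma)
    (hgamma0 : 0 < gamma)
    (hgamma : gamma <
       Num.min 1
         (Num.min (B%:R * L * Q%:R * P%:R)^-1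
           (Num.min (gamma1 B Q P d (min_seq c) L xi)
                    (gamma2 B Q P d (min_seq c) L)))) :
  {ae Pr, forall o,
     (fun t => enorm (sodda hQPd obs x f gam s X t o - wstar)) @ \oo --> 0}.
Proof.
have hmin := hwstar.1.
have cb t : (c t <= b t)%N by case/andP: (hc t).
have L0 : 0 <= L by exact: le_trans ler01 hL.
move: hgamma; rewrite !lt_min => /and4P[_ _ _ hg2].
set rho : R := (min_seq c)%:R / d%:R.
have rho_lt : gamma * L * B%:R ^+ 2 < rho by exact: gamma2_rate hg2.
have d0 : 0 < d%:R :> R by rewrite ltr0n.
have hrho t : rho <= (c t)%:R / d%:R.
  by rewrite ler_pM2r ?invr_gt0// ler_nat min_seq_le.
have rho1 : rho <= 1.
  rewrite ler_pdivrMr// mul1r ler_nat (leq_trans (min_seq_le c 0%N))//.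
  by rewrite -(hbd 0%N).
pose Y t o := gap hQPd obs x f wstar s gam X t o.
have Y0 t o : 0 <= Y t o by exact: gap_ge0.
have mY t : measurable_fun [set: T] (Y t).
  exact: (measurable_comp_sodda hQPd obs x f gam hX
    (fun v => objective x f v - objective x f wstar)).
have Yfin t : (\int[Pr]_o (Y t o)%:E)%E \is a fin_num.
  apply: (integral_comp_sodda_fin_num hQPd obs x f gam hX
    (h := fun v => objective x f v - objective x f wstar)) => v.
  by rewrite subr_ge0.
pose e t := fine (\int[Pr]_o (Y t o)%:E)%E.
have eE t : (\int[Pr]_o (Y t o)%:E)%E = (e t)%:E by rewrite fineK.
have e0 t : 0 <= e t.
  by rewrite -lee_fin -eE; apply: integral_ge0 => o _; rewrite lee_fin.
(* The decrease rate: e_{t+1} <= (1 - kappa) e_t, with kappa > 0 because gamma L B^2 < rho. *)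
set kappa := 2 * xi * (gamma * B%:R * (rho - gamma * L * B%:R ^+ 2)).
have kappa0 : 0 < kappa.
  by rewrite !mulr_gt0 ?ltr0n// subr_gt0.
have descent t : e t.+1 + kappa * e t <= e t.
  rewrite -lee_fin EFinD EFinM -!eE.
  exact: (expected_gap_descent hN hB hQPd obs hf hmin cb hX hxi hconv L0 hLip
    hbd hsN hgamma0 hconst hrho rho_lt rho1).
have telescoped n : kappa * \sum_(0 <= i < n) e i + e n <= e 0%N.
  elim: n => [|n IHn]; first by rewrite big_geq// mulr0 add0r.
  by rewrite big_nat_recr//=; have := descent n; lra.
(* The telescoped inequality with the nonnegative e_n discarded bounds all partial sums by e_0 /
   kappa. *)
have hsum n : (\sum_(0 <= i < n) \int[Pr]_o (Y i o)%:E <= (e 0%N / kappa)%:E)%E.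
  under eq_bigr => i _ do rewrite eE.
  rewrite sumEFin lee_fin ler_pdivlMr// mulrC.
  by have := telescoped n; have := e0 n; lra.
apply: filterS (ae_cvg0_of_summable_expectation Y0 mY hsum) => o hcvg.
apply/cvgr0Pnorm_lt => eps eps0.
(* By quadratic growth, a gap below xi eps^2 / 4 forces a distance below eps. *)
have eps2 : 0 < xi / 4 * eps ^+ 2 by rewrite mulr_gt0 ?divr_gt0 ?exprn_gt0.
move/cvgr0Pnorm_lt: hcvg => /(_ _ eps2); apply: filterS => n.
rewrite (ger0_norm (Y0 n o)) (ger0_norm (enorm_ge0 _)) => hn.
rewrite -(ltr_pXn2r (n := 2))// ?nnegrE ?enorm_ge0 ?(ltW eps0)//.
rewrite -(ltr_pM2l (_ : 0 < xi / 4)) ?divr_gt0//.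
exact: le_lt_trans (quadratic_growth hconv _ hmin) hn.
Qed.
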